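(* For every integer $t$ there is a constant $C=C(t)$ such that for every $n$, $\mathrm{ex}_{\hom}\bigl(n,K_t^{(3)}\bigr)\le C n^{8/3}$. That is, every $3$-uniform hypergraph on $n$ vertices with more than $Cn^{8/3}$ edges contains a subhypergraph whose associated simplicial complex is homeomorphic to (the simplicial complex of) $K_t^{(3)}$.
   Context: A $3$-uniform hypergraph $H$ is identified with the $2$-dimensional simplicial complex whose facets are the edges of $H$ (together with all their faces). $K_t^{(3)}$ denotes the complete $3$-uniform hypergraph on $t$ vertices, viewed as a $2$-dimensional simplicial complex (the $2$-skeleton of the $(t-1)$-simplex). A homeomorph of a $2$-dimensional simplicial complex $X$ in $H$ is a subhypergraph of $H$ whose associated simplicial complex is homeomorphic to $X$. The topological Turán number $\mathrm{ex}_{\hom}(n,X)$ is the maximum number of edges in a $3$-uniform hypergraph on $n$ vertices containing no homeomorph of $X$. *)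

(* Defs.v *)
From HB Require Import structures.
From mathcomp Require Import all_boot all_order all_algebra.
From mathcomp Require Import all_classical all_reals all_analysis.
Set Implicit Arguments. Unset Strict Implicit. Unset Printing Implicit Defensive.
Import Order.TTheory GRing.Theory Num.Theory.
Import numFieldNormedType.Exports.
Local Open Scope classical_set_scope.
Local Open Scope ring_scope.

Definition three_uniform (n : nat) (E : {set {set 'I_n}}) : Prop :=
  forall e, e \in E -> #|e| = 3%N.

Definition complete3 (t : nat) : {set {set 'I_t}} := [set e : {set 'I_t} | #|e| == 3%N].

(* Geometric realization (in R^n, as row vectors) of the simplicial complex whose
   facets are the edges of F: points of the standard simplex whose support is
   contained in some edge of F. *)
Definition realization (R : realType) (n : nat) (F : {set {set 'I_n}}) : set 'rV[R]_n :=
  [set x | (forall i, 0 <= x ord0 i) /\ \sum_i x ord0 i = 1 /\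
           exists2 e, e \in F & forall i, x ord0 i != 0 -> i \in e].

Definition homeomorphic (R : realType) (m k : nat)
    (A : set 'rV[R]_m) (B : set 'rV[R]_k) : Prop :=
  exists (f : 'rV[R]_m -> 'rV[R]_k) (g : 'rV[R]_k -> 'rV[R]_m),
    {within A, continuous f} /\ {within B, continuous g} /\
    (forall x, A x -> B (f x)) /\ (forall y, B y -> A (g y)) /\
    (forall x, A x -> g (f x) = x) /\ (forall y, B y -> f (g y) = y).

Definition contains_hom_Kt (R : realType) (n t : nat) (E : {set {set 'I_n}}) : Prop :=
  exists2 F : {set {set 'I_n}}, F \subset E &
    homeomorphic (@realization R n F) (@realization R t (complete3 t)).

(* Main.v *)
(* For vertices [i], [j], let [G_ij] be the graph of all [xy] such that [xyi] and [xyj] are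
   edges.  Repeatedly cutting along sparse cuts splits [G_ij] into expanders while losing
   only a small fraction of its edges, and two vertices of an expander are joined by a
   path of polylogarithmic length even after deleting polylogarithmically many vertices.
   If [|E| > C n^(8/3)], an average pair [xy] has codegree [d ~ C n^(2/3)], so that
   [d^3 n^2] is much larger than [n^4]; counting then yields an edge [xy] and vertices
   [v_1, ..., v_t] with all [x y v_i] in [E] such that, for all [i], [j], [k], the
   expanders containing [x] in [G_ij], [G_jk] and [G_ik] share many vertices.  Choose
   [p_ij] in the expander of [G_ij] and [z_ijk] in the triple intersections, and join
   [p_ij] to [z_ijk] inside [G_ij] by disjoint short paths.  Coning each path of [G_ij]
   from [v_i] and from [v_j] gives a subdivision of [K_t^(3)] in which [p_ij] and [z_ijk]
   play the roles of the barycentres of the faces [ij] and [ijk]. *)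
Require Import Defs.
From HB Require Import structures.
From mathcomp Require Import all_boot zify.
Set Implicit Arguments. Unset Strict Implicit. Unset Printing Implicit Defensive.

(** * Expander decomposition *)

Definition weight (V : finType) (w : V -> nat) (A : {set V}) : nat :=
  \sum_(v in A) w v.

Definition cut (V : finType) (e : rel V) (A B : {set V}) : nat :=
  \sum_(x in A) #|[set y in B | e x y]|.

(** Conductance above [1 / Q], with [w] in the role of the degree. In the application [w] is the
    degree plus a constant [beta], and this excess pays for deleted vertices. *)
Definition expander (V : finType) (e : rel V) (w : V -> nat) (Q : nat)
    (U : {set V}) : Prop :=
  forall A : {set V}, A \subset U -> A != set0 -> 2 * weight w A <= weight w U ->
  weight w A < Q * cut e A (U :\: A).

Lemma weightD (V : finType) (w : V -> nat) (A U : {set V}) :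
  A \subset U -> weight w U = weight w A + weight w (U :\: A).
Proof. by move=> AU; rewrite /weight (big_setID A) /= (setIidPr AU). Qed.

Lemma weight_le (V : finType) (w : V -> nat) (A U : {set V}) :
  A \subset U -> weight w A <= weight w U.
Proof. by move=> /(weightD w) ->; apply: leq_addr. Qed.

Lemma cutE (V : finType) (e : rel V) (A B : {set V}) :
  cut e A B = \sum_(x in A) \sum_(y in B) e x y.
Proof.
apply: eq_bigr => x _; rewrite -sum1_card big_mkcond /= [RHS]big_mkcond /=.
by apply: eq_bigr => y _; rewrite inE; case: (y \in B); case: (e x y).
Qed.

Lemma cut_sym (V : finType) (e : rel V) (A B : {set V}) :
  symmetric e -> cut e A B = cut e B A.
Proof.
move=> es; rewrite !cutE exchange_big /=.
by apply: eq_bigr => x _; apply: eq_bigr => y _; rewrite es.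
Qed.

(* Cutting along sparse cuts until none is left: every cut is charged to its lighter
   side, and a vertex is charged at most [L] times since its block halves in weight. *)
Lemma expander_partition (V : finType) (e : rel V) (w : V -> nat) (Q L : nat)
    (U : {set V}) :
  symmetric e -> (forall v, 0 < w v) -> weight w U < 2 ^ L ->
  exists lab : V -> {set V},
    [/\ forall x, x \in U -> (x \in lab x) && (lab x \subset U),
        forall x y, x \in U -> y \in lab x -> lab y = lab x,
        forall x, x \in U -> expander e w Q (lab x) &
        Q * (\sum_(x in U) #|[set y in U | e x y && (y \notin lab x)]|)
          <= 2 * (weight w U * L)].
Proof.
move=> es w0; have [N] := ubnP #|U|; elim: N => // N IH in U L *.
rewrite ltnS => UN wU.
have [/existsP[A /and4P[AU A0 AW Acut]] | ] := boolP [exists A : {set V},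
    [&& A \subset U, A != set0, 2 * weight w A <= weight w U &
        Q * cut e A (U :\: A) <= weight w A]]; last first.
  move=> /existsPn noA; exists (fun=> U); split=> //.
  - by move=> x ->; rewrite subxx.
  - move=> x xU A AU A0 AW; rewrite ltnNge; apply/negP => H.
    by have /negP := noA A; apply; rewrite AU A0 AW H.
  - rewrite big1 ?muln0 // => x xU; apply/eqP; rewrite cards_eq0; apply/eqP/setP => y.
    by rewrite !inE; case: (y \in U); rewrite ?andbF.
have wA0 : 0 < weight w A.
  have /set0Pn[a aA] := A0; rewrite /weight (bigD1 a) //=.
  by have := w0 a; lia.
have UA := weightD w AU.
case: L => [|L] in wU *; first by rewrite expn0 in wU; lia.
(* The lighter side recurses with [L] in place of [L.+1]; the [2 * weight w A] saved in this way
   pays for the cut. *)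
have AL : weight w A < 2 ^ L by rewrite expnS in wU; lia.
have ltA : #|A| < N.
  apply: leq_trans UN; apply: proper_card; rewrite properE AU /=.
  by apply/negP => /(weight_le w); lia.
have ltB : #|U :\: A| < N.
  apply: leq_trans UN; rewrite cardsD (setIidPr AU).
  have := subset_leq_card AU; rewrite -card_gt0 in A0; lia.
have [labA [A1 A2 A3 A4]] := IH _ _ ltA AL.
have BL : weight w (U :\: A) < 2 ^ L.+1 by lia.
have [labB [B1 B2 B3 B4]] := IH _ _ ltB BL.
pose lab x := if x \in A then labA x else labB x.
have inB x : x \in U -> x \notin A -> x \in U :\: A by move=> ? ?; rewrite inE; apply/andP.
exists lab; split.
- move=> x xU; rewrite /lab; case: ifPn => xA.
    by have /andP[-> /= H] := A1 _ xA; apply: subset_trans AU.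
  by have /andP[-> /= H] := B1 _ (inB _ xU xA); apply: (subset_trans H); apply: subsetDl.
- move=> x y xU; rewrite /lab; case: ifPn => xA yx.
    have /andP[_ /subsetP H] := A1 _ xA.
    by rewrite (H _ yx); apply: A2.
  have /andP[_ /subsetP H] := B1 _ (inB _ xU xA).
  have := H _ yx; rewrite inE => /andP[/negPf -> _].
  by apply: B2 => //; apply: inB.
- move=> x xU; rewrite /lab; case: ifPn => xA; first exact: A3.
  by apply: B3; apply: inB.
(* A lost edge lies inside one side or crosses the cut. Crossing edges are counted once in each
   direction, whence the factor 2 in the bound. *)
have bnd : \sum_(x in U) #|[set y in U | e x y && (y \notin lab x)]| <=
   \sum_(x in A) #|[set y in A | e x y && (y \notin labA x)]| + cut e A (U :\: A) +
   (\sum_(x in U :\: A) #|[set y in U :\: A | e x y && (y \notin labB x)]|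
     + cut e (U :\: A) A).
  rewrite (big_setID A) /= (setIidPr AU) /cut -!big_split /=.
  apply: leq_add; apply: leq_sum => x; rewrite ?inE => xA.
    rewrite /lab xA -[leqRHS]cardsUI; apply: leq_trans (leq_addr _ _).
    apply: subset_leq_card; apply/subsetP => y; rewrite !inE => /and3P[-> -> ->].
    by case: (y \in A).
  case/andP: xA => /negPf xA _; rewrite /lab xA -[leqRHS]cardsUI.
  apply: leq_trans (leq_addr _ _).
  apply: subset_leq_card; apply/subsetP => y; rewrite !inE => /and3P[-> -> ->].
  by case: (y \in A).
have csym := cut_sym (U :\: A) A es.
rewrite csym in bnd.
have := leq_mul (leqnn Q) bnd; rewrite !mulnDr UA mulnDl.
nia.
Qed.

(** * Short paths avoiding a small vertex set *)

Definition ball_step (V : finType) (e : rel V) (U B : {set V}) : {set V} :=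
  B :|: [set y in U | [exists x in B, e x y]].

Lemma ball_path (V : finType) (e : rel V) (U : {set V}) (p : V) (r : nat) (y : V) :
  y \in iter r (ball_step e U) [set p] ->
  exists s, [/\ path e p s, last p s = y, {subset s <= U} & size s <= r].
Proof.
elim: r y => [|r IH] y /=.
  by rewrite inE => /eqP ->; exists [::].
rewrite inE => /orP[/IH [s [? ? ? ?]]|]; first by exists s; split=> //; lia.
rewrite inE => /andP[yU /existsP[x /andP[/IH [s [s1 s2 s3 s4]] xy]]].
exists (rcons s y); split.
- by rewrite rcons_path s1 s2.
- by rewrite last_rcons.
- by move=> a; rewrite mem_rcons inE => /predU1P[-> //|]; apply: s3.
- by rewrite size_rcons.
Qed.

Lemma ball_sub (V : finType) (e : rel V) (U : {set V}) (p : V) (r : nat) :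
  p \in U -> iter r (ball_step e U) [set p] \subset U.
Proof.
move=> pU; elim: r => [|r IH] /=; first by rewrite sub1set.
by rewrite subUset IH /=; apply/subsetP => y; rewrite inE => /andP[].
Qed.

(** Expansion in [U] gives more than [weight w B / Q] edges leaving [B]. Deleting [W] destroys at
    most [M] of them per vertex of [B], which the excess [2 * Q * M] in [w] keeps below half of that
    number. A new vertex receives at most its degree, hence at most its weight, of the remaining
    edges. *)
Lemma ball_grows (V : finType) (e : rel V) (w : V -> nat) (Q M : nat)
    (U W B : {set V}) :
  symmetric e -> (forall v, #|[set y | e v y]| + 2 * Q * M <= w v) ->
  expander e w Q U -> #|W| <= M -> B \subset U :\: W -> B != set0 ->
  2 * weight w B <= weight w U ->
  weight w B <= 2 * Q * (weight w (ball_step e (U :\: W) B) - weight w B).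
Proof.
move=> es wdeg Uexp WM BU B0 BW.
have BU' : B \subset U by apply: (subset_trans BU); apply: subsetDl.
have H1 := Uexp B BU' B0 BW.
set C := (U :\: W) :\: B.
have H2 : cut e B (U :\: B) <= cut e B C + #|B| * M.
  rewrite /cut -sum_nat_const -big_split /=; apply: leq_sum => x xB.
  apply: leq_trans (leq_add (leqnn _) WM); rewrite -[leqRHS]cardsUI.
  apply: leq_trans (leq_addr _ _); apply: subset_leq_card; apply/subsetP => y.
  by rewrite !inE => /andP[/andP[-> ->] ->]; case: (y \in W).
have H3 : #|B| * (2 * Q * M) <= weight w B.
  rewrite -sum_nat_const; apply: leq_sum => v _.
  by apply: leq_trans (wdeg v); apply: leq_addl.
have H4 : weight w B + cut e B C <= weight w (ball_step e (U :\: W) B).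
  have sB : B \subset ball_step e (U :\: W) B by apply: subsetUl.
  rewrite (weightD w sB) leq_add2l cut_sym // /cut.
  rewrite (big_setID (ball_step e (U :\: W) B :\: B)) /= addnC big1 ?add0n; last first.
    move=> y; rewrite !inE => /andP[H /andP[yB yUW]]; apply/eqP; rewrite cards_eq0.
    apply/eqP/setP => x; rewrite !inE; apply/negP => /andP[xB yx].
    move: H; rewrite yB yUW /= negb_or yB /= => /negP; apply.
    by apply/existsP; exists x; rewrite xB es.
  apply: (@leq_trans (\sum_(y in C :&: (ball_step e (U :\: W) B :\: B)) w y)).
    apply: leq_sum => y _; apply: leq_trans (wdeg y); apply: leq_trans (leq_addr _ _).
    by apply: subset_leq_card; apply/subsetP => x; rewrite !inE => /andP[].
  by apply: weight_le; apply: subsetIr.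
have H5 : cut e B C <= weight w (ball_step e (U :\: W) B) - weight w B by lia.
have := leq_mul (leqnn (2 * Q)) H5.
have := leq_mul (leqnn Q) H2; nia.
Qed.

(** As long as a ball holds at most half of the weight, [2 * Q] further steps double it; [L]
    doublings would exceed the weight of [U]. *)
Lemma ball_large (V : finType) (e : rel V) (w : V -> nat) (Q M L : nat)
    (U W : {set V}) (p : V) :
  symmetric e -> (forall v, 0 < w v) ->
  (forall v, #|[set y | e v y]| + 2 * Q * M <= w v) ->
  expander e w Q U -> weight w U < 2 ^ L -> #|W| <= M -> p \in U :\: W ->
  weight w U < 2 * weight w (iter (2 * Q * L) (ball_step e (U :\: W)) [set p]).
Proof.
move=> es w0 wdeg Uexp UL WM pU.
pose B r := iter r (ball_step e (U :\: W)) [set p].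
have Bmono r h : B r \subset B (h + r).
  by elim: h => // h IH; rewrite addSn; apply: (subset_trans IH); apply: subsetUl.
have B0 r : B r != set0.
  by apply/set0Pn; exists p; have /subsetP := Bmono 0 r; rewrite addn0; apply; rewrite inE.
(* Each step gains at least [weight w (B r) / (2 * Q)], so [h = 2 * Q] gives a doubling. *)
have Bgrow r h : 2 * weight w (B (h + r)) <= weight w U ->
    h * weight w (B r) + 2 * Q * weight w (B r) <= 2 * Q * weight w (B (h + r)).
  elim: h => // h IH; rewrite addSn => lt.
  have le1 : weight w (B (h + r)) <= weight w (B (h + r).+1).
    by apply: weight_le; apply: subsetUl.
  have le2 := weight_le w (Bmono r h).
  have lt' : 2 * weight w (B (h + r)) <= weight w U by lia.
  have := ball_grows es wdeg Uexp WM (ball_sub e (h + r) pU) (B0 _) lt'.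
  rewrite -/(B (h + r)) -[ball_step _ _ _]/(B (h + r).+1).
  have := IH lt'; nia.
suff claim s : 2 ^ s <= weight w (B (2 * Q * s)) \/
               weight w U < 2 * weight w (B (2 * Q * s)).
  case: (claim L) => // H.
  have := weight_le w (subset_trans (ball_sub e (2 * Q * L) pU) (subsetDl U W)).
  rewrite -/(B _); lia.
elim: s => [|s IH].
  left; rewrite muln0 /B /= /weight big_set1 expn0; exact: w0.
have := weight_le w (Bmono (2 * Q * s) (2 * Q)); rewrite -mulnS => mon.
have [|gt] := leqP (2 * weight w (B (2 * Q * s.+1))) (weight w U); last by right.
move=> le; left; case: IH => IH; last by lia.
have := Bgrow (2 * Q * s) (2 * Q); rewrite -mulnS => /(_ le).
(* For [Q = 0], expansion of the light set [[set p]] would demand a weight below 0. *)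
have Q0 : 0 < Q.
  case: (Q) Uexp => // Uexp0.
  have pU' : [set p] \subset U by rewrite sub1set; move: pU; rewrite inE => /andP[].
  have := Uexp0 [set p] pU' (B0 0).
  have := weight_le w (Bmono 0 (2 * Q * s.+1)).
  rewrite addn0 [weight w (B 0)]/(weight w [set p]); lia.
rewrite expnS; set a := weight _ _; set b := weight _ _; nia.
Qed.

(** The balls around [p] and [z] each hold more than half of the weight of [U], so they meet; the
    two paths to a common vertex are joined and shortened to a simple one. *)
Lemma expander_short_path (V : finType) (e : rel V) (w : V -> nat) (Q M L : nat)
    (U W : {set V}) (p z : V) :
  symmetric e -> (forall v, 0 < w v) ->
  (forall v, #|[set y | e v y]| + 2 * Q * M <= w v) ->
  expander e w Q U -> weight w U < 2 ^ L -> #|W| <= M ->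
  p \in U :\: W -> z \in U :\: W ->
  exists s, [/\ path e p s, last p s = z, {subset s <= U :\: W}, uniq (p :: s) &
                size s <= 4 * Q * L].
Proof.
move=> es w0 wdeg Uexp UL WM pU zU.
pose B x := iter (2 * Q * L) (ball_step e (U :\: W)) [set x].
have large x : x \in U :\: W -> weight w U < 2 * weight w (B x).
  by move=> xU; apply: (@ball_large _ _ _ _ M).
have sub x : x \in U :\: W -> B x \subset U.
  by move=> xU; apply: (subset_trans (ball_sub _ _ xU)); apply: subsetDl.
have [y yp yz] : exists2 y, y \in B p & y \in B z.
  have [dis|/pred0Pn[y /andP[yp yz]]] := boolP [disjoint B p & B z]; last by exists y.
  have : weight w (B p) + weight w (B z) <= weight w U.
    rewrite (weightD w (sub p pU)) leq_add2l; apply: weight_le.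
    by rewrite subsetD sub //= disjoint_sym.
  by have := large p pU; have := large z zU; lia.
have [s1 [p1 l1 u1 z1]] := ball_path yp.
have [s2 [p2 l2 u2 z2]] := ball_path yz.
pose s3 := rev (belast z s2).
have p3 : path e y s3.
  rewrite /s3 -l2 rev_path.
  by rewrite (eq_path (e' := e)) // => a b; rewrite es.
have l3 : last y s3 = z.
  rewrite /s3 -l2; case: (s2) => //= a s'; by rewrite rev_cons last_rcons.
have u3 : {subset s3 <= U :\: W}.
  move=> a; rewrite mem_rev => /mem_belast; rewrite inE => /predU1P[->//|]; exact: u2.
have p4 : path e p (s1 ++ s3) by rewrite cat_path p1 l1.
have l4 : last p (s1 ++ s3) = z by rewrite last_cat l1.
case/shortenP: p4 l4 => s p5 u5 sub5 l5.
exists s; split=> //.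
  by move=> a /sub5; rewrite mem_cat => /orP[/u1|/u3].
have us : uniq s by case/andP: u5.
apply: (leq_trans (uniq_leq_size us sub5)).
rewrite size_cat size_rev size_belast.
have -> : 4 * Q * L = 2 * Q * L + 2 * Q * L by nia.
exact: leq_add.
Qed.

(** * Choosing the branch vertices *)

Lemma card_sum_bool (T : finType) (P : pred T) :
  #|[set x | P x]| = \sum_(x : T) P x.
Proof.
by rewrite -sum1_card big_mkcond /=; apply: eq_bigr => x _; rewrite inE; case: (P x).
Qed.

Lemma sum_sqr_ge (I : finType) (d : I -> nat) :
  (\sum_i d i) ^ 2 <= #|I| * \sum_i d i ^ 2.
Proof.
rewrite -(leq_pmul2l (isT : 0 < 2)) expnS expn1 big_distrl /= big_distrr /=.
apply: (@leq_trans (\sum_i \sum_j (d i ^ 2 + d j ^ 2))).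
  apply: leq_sum => i _; rewrite big_distrr big_distrr /=.
  by apply: leq_sum => j _; apply: nat_Cauchy.
under eq_bigr => i _ do rewrite big_split sum_nat_const /=.
by rewrite big_split /= sum_nat_const -big_distrr /= addnn mul2n.
Qed.

(** For a random map from [T] to [N], the values at [a] and [b] form a pair of [B] with probability
    at most [#|B| / #|N| ^ 2]. Overwriting these two values by a pair from [N] while remembering the
    old pair is injective. *)
Lemma card_ffun_bad2 (T V : finType) (N : {set V}) (B : {set V * V}) (a b : T) :
  a != b ->
  #|[set f : {ffun T -> V} | [forall x, f x \in N] && ((f a, f b) \in B)]| * #|N| ^ 2
    <= #|B| * #|N| ^ #|T|.
Proof.
move=> ab.
have NT : #|N| ^ #|T| = #|[set f : {ffun T -> V} | [forall x, f x \in N]]|.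
  rewrite -[LHS](@card_ffun_on _ _ (mem N)) cardsE; apply: eq_card => f.
  by apply/ffun_onP/forallP.
rewrite NT expnS expn1 -!cardsX.
pose upd (f : {ffun T -> V}) (u : V * V) : {ffun T -> V} :=
  [ffun x => if x == a then u.1 else if x == b then u.2 else f x].
pose h (g : {ffun T -> V} * (V * V)) := ((g.1 a, g.1 b), upd g.1 g.2).
have inj : injective h.
  move=> [f [u1 u2]] [g [w1 w2]] [ea eb /ffunP E].
  have u1w : u1 = w1 by have := E a; rewrite !ffunE eqxx.
  have u2w : u2 = w2 by have := E b; rewrite !ffunE eqxx eq_sym (negPf ab).
  rewrite u1w u2w; congr pair; apply/ffunP => x.
  have := E x; rewrite !ffunE.
  by case: (x =P a) => [->|_] //; case: (x =P b) => [->|].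
rewrite -(card_imset _ inj); apply: subset_leq_card; apply/subsetP => g /imsetP[[f u]].
rewrite !inE /= => /andP[/andP[/forallP fN fB] /andP[u1 u2]] -> /=.
rewrite fB /=; apply/forallP => x; rewrite ffunE.
by case: ifP => // _; case: ifP.
Qed.

Lemma card_ffun_bad3 (T V : finType) (N : {set V}) (B : {set V * V * V}) (a b c : T) :
  a != b -> a != c -> b != c ->
  #|[set f : {ffun T -> V} | [forall x, f x \in N] && ((f a, f b, f c) \in B)]|
    * #|N| ^ 3 <= #|B| * #|N| ^ #|T|.
Proof.
move=> ab ac bc.
have NT : #|N| ^ #|T| = #|[set f : {ffun T -> V} | [forall x, f x \in N]]|.
  rewrite -[LHS](@card_ffun_on _ _ (mem N)) cardsE; apply: eq_card => f.
  by apply/ffun_onP/forallP.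
have N3 : #|N| ^ 3 = #|setX (setX N N) N| by rewrite !cardsX !expnS expn0 muln1 mulnA.
rewrite NT N3 -!cardsX.
pose upd (f : {ffun T -> V}) (u : V * V * V) : {ffun T -> V} :=
  [ffun x => if x == a then u.1.1 else if x == b then u.1.2 else
             if x == c then u.2 else f x].
pose h (g : {ffun T -> V} * (V * V * V)) := ((g.1 a, g.1 b, g.1 c), upd g.1 g.2).
have inj : injective h.
  move=> [f [[u1 u2] u3]] [g [[w1 w2] w3]] [ea eb ec /ffunP E].
  have u1w : u1 = w1 by have := E a; rewrite !ffunE eqxx.
  have u2w : u2 = w2 by have := E b; rewrite !ffunE eqxx eq_sym (negPf ab).
  have u3w : u3 = w3.
    by have := E c; rewrite !ffunE eqxx eq_sym (negPf ac) eq_sym (negPf bc).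
  rewrite u1w u2w u3w; congr pair; apply/ffunP => x.
  have := E x; rewrite !ffunE.
  by case: (x =P a) => [->|_] //; case: (x =P b) => [->|_] //; case: (x =P c) => [->|].
rewrite -(card_imset _ inj); apply: subset_leq_card; apply/subsetP => g.
move=> /imsetP[[f [[u1 u2] u3]]].
rewrite !inE /= => /andP[/andP[/forallP fN fB] /andP[/andP[n1 n2] n3]] -> /=.
rewrite fB /=; apply/forallP => x; rewrite ffunE.
by case: ifP => // _; case: ifP => // _; case: ifP.
Qed.

(** A union bound: bad pairs and bad triples each spoil fewer than half of the maps into [N]. *)
Lemma exists_good_ffun (T V : finType) (N : {set V}) (B2 : {set V * V})
    (B3 : {set V * V * V}) :
  2 * #|T| ^ 2 * #|B2| < #|N| ^ 2 -> 2 * #|T| ^ 3 * #|B3| < #|N| ^ 3 ->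
  exists f : T -> V, [/\ forall a, f a \in N,
    forall a b, a != b -> (f a, f b) \notin B2 &
    forall a b c, a != b -> a != c -> b != c -> (f a, f b, f c) \notin B3].
Proof.
move=> h2 h3.
pose onN (f : {ffun T -> V}) := [forall x, f x \in N].
pose bad2 (p : T * T) := [set f : {ffun T -> V} | onN f && ((f p.1, f p.2) \in B2)].
pose bad3 (p : T * T * T) :=
  [set f : {ffun T -> V} | onN f && ((f p.1.1, f p.1.2, f p.2) \in B3)].
pose all2 := \bigcup_(p | p.1 != p.2) bad2 p.
pose all3 := \bigcup_(p | [&& p.1.1 != p.1.2, p.1.1 != p.2 & p.1.2 != p.2]) bad3 p.
have N0 : 0 < #|N| by case: #|N| h2 => //; rewrite expnS mul0n.
have NT0 : 0 < #|N| ^ #|T| by rewrite expn_gt0 N0.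
have NT : #|N| ^ #|T| = #|[set f : {ffun T -> V} | onN f]|.
  rewrite -[LHS](@card_ffun_on _ _ (mem N)) cardsE; apply: eq_card => f.
  by apply/ffun_onP/forallP.
have c2 : #|all2| * #|N| ^ 2 <= #|T| ^ 2 * (#|B2| * #|N| ^ #|T|).
  apply: (@leq_trans (\sum_(p : T * T | p.1 != p.2) #|bad2 p| * #|N| ^ 2)).
    rewrite -big_distrl /= leq_mul2r; apply/orP; right.
    by rewrite /all2; elim/big_ind2: _ => [|A1 n1 A2 n2 le1 le2|//]; rewrite ?cards0 //;
      apply: leq_trans (leq_add le1 le2); rewrite -cardsUI leq_addr.
  apply: (@leq_trans (\sum_(p : T * T) #|B2| * #|N| ^ #|T|)).
    rewrite big_mkcond /=; apply: leq_sum => p _; case: ifP => // ab.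
    exact: card_ffun_bad2.
  by rewrite sum_nat_const card_prod mulnn.
have c3 : #|all3| * #|N| ^ 3 <= #|T| ^ 3 * (#|B3| * #|N| ^ #|T|).
  apply: (@leq_trans (\sum_(p : T * T * T |
      [&& p.1.1 != p.1.2, p.1.1 != p.2 & p.1.2 != p.2]) #|bad3 p| * #|N| ^ 3)).
    rewrite -big_distrl /= leq_mul2r; apply/orP; right.
    by rewrite /all3; elim/big_ind2: _ => [|A1 n1 A2 n2 le1 le2|//]; rewrite ?cards0 //;
      apply: leq_trans (leq_add le1 le2); rewrite -cardsUI leq_addr.
  apply: (@leq_trans (\sum_(p : T * T * T) #|B3| * #|N| ^ #|T|)).
    rewrite big_mkcond /=; apply: leq_sum => p _; case: ifP => // /and3P[? ? ?].
    exact: card_ffun_bad3.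
  by rewrite sum_nat_const !card_prod (_ : #|T| ^ 3 = #|T| * #|T| * #|T|) //; lia.
have l2 : 2 * #|all2| < #|N| ^ #|T|.
  rewrite -(ltn_pmul2r (_ : 0 < #|N| ^ 2)) ?expn_gt0 ?N0 //.
  have := c2; move: h2; rewrite -(ltn_pmul2r NT0); nia.
have l3 : 2 * #|all3| < #|N| ^ #|T|.
  rewrite -(ltn_pmul2r (_ : 0 < #|N| ^ 3)) ?expn_gt0 ?N0 //.
  have := c3; move: h3; rewrite -(ltn_pmul2r NT0); nia.
have /subsetPn[f] : ~~ ([set f : {ffun T -> V} | onN f] \subset all2 :|: all3).
  apply/negP => /subset_leq_card; rewrite -NT.
  have := cardsUI all2 all3; lia.
rewrite !inE => fN /norP[f2 f3]; exists f; split.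
- exact/forallP.
- move=> a b ab; apply: contra f2 => fB.
  by apply/bigcupP; exists (a, b) => //; rewrite inE fN.
- move=> a b c ab ac bc; apply: contra f3 => fB.
  by apply/bigcupP; exists (a, b, c); rewrite ?inE ?fN //= ab ac bc.
Qed.

(** [link E [set i; j]] is the graph [G_ij]; taking a set as argument indexes the graphs by
    unordered pairs. *)
Definition link (V : finType) (E : {set {set V}}) (S : {set V}) : rel V :=
  fun x y => [forall i in S, [set x; y; i] \in E].

Definition codegree (V : finType) (E : {set {set V}}) (x y : V) : nat :=
  #|[set i | [set x; y; i] \in E]|.

Lemma link_sym (V : finType) (E : {set {set V}}) (S : {set V}) : symmetric (link E S).
Proof.
by move=> x y; apply: eq_forallb => i; rewrite (setUC [set x] [set y]).
Qed.

Lemma link2E (V : finType) (E : {set {set V}}) (i j x y : V) :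
  link E [set i; j] x y = ([set x; y; i] \in E) && ([set x; y; j] \in E).
Proof.
apply/forall_inP/andP => [H|[Ei Ej] k]; last by rewrite !inE => /orP[]/eqP->.
by split; apply: H; rewrite !inE eqxx ?orbT.
Qed.

Lemma sum_codegree_ge (V : finType) (E : {set {set V}}) :
  (forall e, e \in E -> #|e| = 3) ->
  #|E| <= \sum_x \sum_y codegree E x y.
Proof.
move=> E3.
pose f (p : V * V * V) := [set p.1.1; p.1.2; p.2].
have sub : E \subset [set f p | p in [set p | f p \in E]].
  apply/subsetP => e eE; have /eqP := E3 _ eE.
  have /set0Pn[x xe] : e != set0 by rewrite -card_gt0 E3.
  rewrite (cardsD1 x) xe add1n eqSS => /cards2P[y [z [_ eq]]].
  have ef : e = f (y, z, x) by rewrite /f /= -eq setUC setD1K.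
  by apply/imsetP; exists (y, z, x) => //; rewrite inE -ef.
apply: (leq_trans (subset_leq_card sub)); apply: (leq_trans (leq_imset_card _ _)).
rewrite card_sum_bool pair_big /= /codegree.
under [leqRHS]eq_bigr => p _ do rewrite card_sum_bool.
by rewrite pair_big.
Qed.

(* [sigma] is comparable with the average codegree: a pair [xy] of codegree at most [sigma]
   contributes little to the sum of the squared codegrees, and for the others the bad
   triples are compared with [d ^ 3 >= sigma * d ^ 2]. *)
Lemma exists_good_star (V : finType) (E : {set {set V}}) (t K Q L beta sigma : nat)
    (lab : {set V} -> V -> {set V}) :
  (forall e, e \in E -> #|e| = 3) ->
  (forall S x y, y \in lab S x -> lab S y = lab S x) ->
  (forall S, Q * (\sum_x #|[set y | link E S x y && (y \notin lab S x)]|)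
    <= 2 * ((\sum_x (#|[set y | link E S x y]| + beta)) * L)) ->
  Q = 16 * t ^ 2 * L -> 0 < L -> 0 < t -> 8 * t ^ 2 <= beta ->
  0 < #|V| -> 0 < sigma -> 2 * sigma * #|V| ^ 2 <= #|E| ->
  #|V| * beta <= sigma ^ 2 -> 2 * t ^ 3 * K * #|V| ^ 2 < sigma ^ 3 ->
  exists (x : V) (v : 'I_t -> V), injective v /\
    forall a b c, a != b -> a != c -> b != c ->
      K <= #|lab [set v a; v b] x :&: lab [set v b; v c] x :&: lab [set v a; v c] x|.
Proof.
move=> E3 labeq labbad Qd L0 t0 tbeta n0 s0 Ebig sbeta sK; set n := #|V| in n0 Ebig sbeta sK.
pose d := codegree E.
pose N x y := [set i | [set x; y; i] \in E].
(* Bad pairs are the diagonal ones, whose exclusion makes the star injective, and those for which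
   the decomposition of [G_ij] loses the edge [xy]. *)
pose B2 x y := [set p : V * V | (p.1 == p.2) && (p.1 \in N x y) ||
   (link E [set p.1; p.2] x y && (y \notin lab [set p.1; p.2] x))].
pose cls x i j k := lab [set i; j] x :&: lab [set j; k] x :&: lab [set i; k] x.
pose B3 x y := [set p : V * V * V | (#|cls x p.1.1 p.1.2 p.2| < K) &&
    (y \in cls x p.1.1 p.1.2 p.2)].
have [/existsP[x /existsP[y /andP[h2 h3]]] | none] := boolP [exists x, exists y,
    (2 * t ^ 2 * #|B2 x y| < d x y ^ 2) && (2 * t ^ 3 * #|B3 x y| < d x y ^ 3)].
  have := @exists_good_ffun 'I_t V (N x y) (B2 x y) (B3 x y).
  rewrite card_ord => /(_ h2 h3)[f [fN fB2 fB3]].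
  have finj : injective f.
    move=> a b eq; apply/eqP/negPn/negP => /fB2; rewrite inE /= eq eqxx.
    by rewrite fN.
  exists x, f; split=> // a b c ab ac bc; rewrite leqNgt; apply/negP => lt.
  have := fB3 a b c ab ac bc; rewrite inE /= lt /= => /negP; apply.
  (* Avoiding bad pairs puts [y] into every expander concerned, so a small triple intersection would
     be a bad triple. *)
  have ylab i j : i != j -> y \in lab [set f i; f j] x.
    move=> ij; have := fB2 i j ij; rewrite inE /= negb_or => /andP[_].
    rewrite link2E; have := fN i; have := fN j; rewrite !inE => -> -> /=.
    by rewrite negbK.
  by rewrite !inE !ylab.
exfalso.
(* From here every pair [xy] fails one of the two bounds, which is refuted by summing over all
   pairs. The sum [S2] also counts the ordered edges of all graphs [G_ij]. *)
pose S1 := \sum_x \sum_y d x y.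
pose S2 := \sum_x \sum_y d x y ^ 2.
pose T2 := \sum_x \sum_y #|B2 x y|.
pose T3 := \sum_x \sum_y #|B3 x y|.
have S1E : 2 * sigma * n ^ 2 <= S1 by apply: (leq_trans Ebig); apply: sum_codegree_ge.
have CS : S1 ^ 2 <= n ^ 2 * S2.
  have := @sum_sqr_ge (V * V)%type (fun p => d p.1 p.2).
  by rewrite -(pair_bigA _ d) -(pair_bigA _ (fun x y => d x y ^ 2)) card_prod mulnn.
have S1n : S1 <= n ^ 3.
  apply: (@leq_trans (\sum_(x : V) \sum_(y : V) n)).
    by apply: leq_sum => x _; apply: leq_sum => y _; apply: max_card.
  by rewrite !sum_nat_const -/n; lia.
(* For fixed [x] and a fixed triple, the bad [y] all lie in one set of fewer than [K] vertices. *)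
have T3n : T3 <= n ^ 4 * K.
  rewrite /T3.
  under eq_bigr => x _ do under eq_bigr => y _ do rewrite card_sum_bool.
  under eq_bigr => x _ do rewrite exchange_big /=.
  apply: (@leq_trans (\sum_(x : V) \sum_(p : V * V * V) K)).
    apply: leq_sum => x _; apply: leq_sum => p _; rewrite -card_sum_bool.
    have [lt|_] := ltnP #|cls x p.1.1 p.1.2 p.2| K; last first.
      by rewrite (_ : [set _ | _] = set0) ?cards0 //; apply/setP => y; rewrite !inE.
    by rewrite /= cardsE; apply: ltnW.
  by rewrite !sum_nat_const !card_prod -/n; lia.
pose Y := \sum_(i : V) \sum_(j : V)
      \sum_x #|[set y | link E [set i; j] x y && (y \notin lab [set i; j] x)]|.
have T2Y : T2 <= S1 + Y.
  rewrite /Y pair_big /= exchange_big /= /S1 -big_split /=; apply: leq_sum => x _.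
  under [\sum_(p : V * V) _]eq_bigr => p _ do rewrite card_sum_bool.
  rewrite exchange_big /= -big_split /=; apply: leq_sum => y _.
  rewrite -card_sum_bool.
  have -> : d x y = #|[set p : V * V | (p.1 == p.2) && (p.1 \in N x y)]|.
    rewrite -[LHS]/#|N x y| -(card_imset (N x y) (f := fun i => (i, i))); last by move=> i j [].
    apply: eq_card => -[i j]; rewrite !inE /=; apply/imsetP/andP.
      by move=> [k kN [-> ->]]; rewrite inE in kN.
    by move=> [/eqP-> iN]; exists j => //; rewrite inE.
  rewrite -cardsUI; apply: leq_trans (leq_addr _ _).
  by apply: subset_leq_card; apply/subsetP => p; rewrite !inE.
have QY : Q * Y <= 2 * ((S2 + n ^ 3 * beta) * L).
  have -> : S2 = \sum_(i : V) \sum_(j : V) \sum_x #|[set y | link E [set i; j] x y]|.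
    rewrite pair_big /= exchange_big /=; apply: eq_bigr => x _.
    under [RHS]eq_bigr => p _ do rewrite card_sum_bool.
    rewrite exchange_big /=; apply: eq_bigr => y _.
    rewrite expnS expn1 -cardsX card_sum_bool.
    by apply: eq_bigr => p _; rewrite link2E !inE.
  have -> : n ^ 3 * beta = \sum_(i : V) \sum_(j : V) \sum_(x : V) beta.
    by rewrite !sum_nat_const -/n; lia.
  rewrite -big_split big_distrl !big_distrr; apply: leq_sum => i _.
  rewrite -big_split big_distrl !big_distrr; apply: leq_sum => j _.
  by rewrite -big_split; apply: labbad.
have T2n : Q * T2 <= Q * n ^ 3 + 2 * ((S2 + n ^ 3 * beta) * L).
  have : Q * T2 <= Q * (n ^ 3 + Y) by rewrite leq_mul2l; apply/orP; right; lia.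
  by rewrite mulnDr; lia.
have key x y : sigma * d x y ^ 2 <=
    2 * t ^ 2 * sigma * #|B2 x y| + (sigma ^ 3 + 2 * t ^ 3 * #|B3 x y|).
  move: none => /existsPn/(_ x)/existsPn/(_ y); rewrite negb_and -!leqNgt.
  set D := d x y; case/orP => H.
    have := leq_mul (leqnn sigma) H; nia.
  have [le|lt] := leqP D sigma.
    have : D ^ 2 <= sigma ^ 2 by rewrite leq_exp2r.
    nia.
  have : sigma * D ^ 2 <= D ^ 3 by rewrite (expnS D 2) leq_mul2r ltnW ?orbT.
  nia.
have Sum : sigma * S2 <= 2 * t ^ 2 * sigma * T2 + (n ^ 2 * sigma ^ 3 + 2 * t ^ 3 * T3).
  have -> : n ^ 2 * sigma ^ 3 = \sum_(x : V) \sum_(y : V) sigma ^ 3.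
    by rewrite !sum_nat_const -/n; lia.
  rewrite /S2 /T2 /T3 !big_distrr /= -!big_split /=; apply: leq_sum => x _.
  rewrite !big_distrr /= -!big_split /=; apply: leq_sum => y _.
  exact: key.
(* The value of [Q] limits the lost edges to a share [1 / (8 * t ^ 2)] of [S2 + n ^ 3 * beta]; the
   diagonal pairs fit into a second [n ^ 3 * beta]. *)
have T2b : 8 * t ^ 2 * T2 <= S2 + 2 * (n ^ 3 * beta).
  have Q8 : 8 * t ^ 2 * (2 * L) = Q by rewrite Qd; nia.
  rewrite -(leq_pmul2r (_ : 0 < 2 * L)) ?muln_gt0 //.
  apply: (@leq_trans (Q * T2)); first by rewrite -Q8; nia.
  apply: (leq_trans T2n); rewrite -Q8.
  have : 8 * t ^ 2 * n ^ 3 <= n ^ 3 * beta by rewrite mulnC leq_mul2l tbeta orbT.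
  nia.
have S2b : 4 * sigma ^ 2 * n ^ 2 <= S2.
  rewrite -(leq_pmul2l (_ : 0 < n ^ 2)) ?expn_gt0 ?n0 //; apply: leq_trans CS.
  have : (2 * sigma * n ^ 2) ^ 2 <= S1 ^ 2 by rewrite leq_exp2r.
  nia.
(* Writing [X] for [n ^ 2 * sigma ^ 3], the facts below make the left side at least [12 X] and the
   right side less than [10 X]. *)
have e1 : 3 * (sigma * S2) <= 2 * (sigma * (n ^ 3 * beta)) + 4 * (n ^ 2 * sigma ^ 3)
   + 8 * t ^ 3 * (n ^ 4 * K).
  have : 8 * t ^ 3 * T3 <= 8 * t ^ 3 * (n ^ 4 * K) by rewrite leq_mul2l T3n orbT.
  have := leq_mul (leqnn sigma) T2b; nia.
have e2 : 12 * (n ^ 2 * sigma ^ 3) <= 3 * (sigma * S2).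
  have := leq_mul (leqnn sigma) S2b; nia.
have e3 : sigma * (n ^ 3 * beta) <= n ^ 2 * sigma ^ 3.
  have : sigma * n ^ 2 * (n * beta) <= sigma * n ^ 2 * sigma ^ 2.
    by rewrite leq_mul2l sbeta orbT.
  rewrite !expnS !expn0; nia.
have e4 : 8 * t ^ 3 * (n ^ 4 * K) < 4 * (n ^ 2 * sigma ^ 3).
  have : (4 * n ^ 2) * (2 * t ^ 3 * K * n ^ 2) < 4 * n ^ 2 * sigma ^ 3.
    by rewrite ltn_pmul2l // muln_gt0 expn_gt0 n0.
  rewrite !expnS !expn0; nia.
lia.
Qed.

(** * Embedding the paths *)

(** The sequences are picked one after another; together with [W0], those already picked never cover
    more than [M] vertices. This serves twice: for the vertices of the subdivision, as sequences of
    length one, and for the paths joining them. *)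
Lemma greedy_disjoint (I V : finType) (P : I -> seq V -> Prop) (ell M : nat)
    (W0 : {set V}) :
  (forall i (W : {set V}), W0 \subset W -> #|W| <= M ->
    exists s, [/\ P i s, size s <= ell & forall y, y \in s -> y \notin W]) ->
  #|W0| + #|I| * ell <= M ->
  exists s : I -> seq V, [/\ forall i, P i (s i),
    forall i y, y \in s i -> y \notin W0 &
    forall i j y, y \in s i -> y \in s j -> i = j].
Proof.
move=> step bound.
suff /(_ (enum I) (enum_uniq _))[] : forall r : seq I, uniq r ->
    exists s : I -> seq V, [/\ forall i, i \in r -> P i (s i) /\ size (s i) <= ell,
      forall i y, i \in r -> y \in s i -> y \notin W0 &
      forall i j y, i \in r -> j \in r -> y \in s i -> y \in s j -> i = j].
  move=> s [sP s0 sD]; exists s; split.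
  - by move=> i; case: (sP i) => //; rewrite mem_enum.
  - by move=> i y; apply: s0; rewrite mem_enum.
  - by move=> i j y; apply: sD; rewrite mem_enum.
elim=> [|a r IH] /=; first by exists (fun=> [::]).
move=> /andP[ar ur]; have [s [sP s0 sD]] := IH ur.
pose W := W0 :|: \bigcup_(i in r) [set y in s i].
have cW : #|W| <= M.
  apply: leq_trans bound; apply: (@leq_trans (#|W0| + #|\bigcup_(i in r) [set y in s i]|)).
    by rewrite -cardsUI leq_addr.
  rewrite leq_add2l.
  apply: (@leq_trans (\sum_(i in r) #|[set y in s i]|)).
    elim/big_ind2: _ => [|A1 n1 A2 n2 le1 le2|//]; first by rewrite cards0.
    by apply: leq_trans (leq_add le1 le2); rewrite -cardsUI leq_addr.
  rewrite -sum_nat_const big_mkcond /=; apply: leq_sum => i _; case: ifP => // ir.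
  case: (sP i ir) => _ le; apply: leq_trans le.
  by rewrite cardsE; apply: card_size.
have [u [Pu su uW]] := step a W (subsetUl _ _) cW.
pose s' i := if i == a then u else s i.
have s'r i : i \in r -> s' i = s i.
  by move=> ir; rewrite /s'; case: eqP => // eq; rewrite -eq ir in ar.
have uW' i y : i \in r -> y \in u -> y \notin s i.
  move=> ir /uW; rewrite inE negb_or => /andP[_]; apply: contra => ys.
  by apply/bigcupP; exists i => //; rewrite inE.
exists s'; split.
- move=> i; rewrite inE => /predU1P[->|ir]; first by rewrite /s' eqxx.
  by rewrite s'r //; apply: sP.
- move=> i y; rewrite inE => /predU1P[->|ir]; last by rewrite s'r //; apply: s0.
  by rewrite /s' eqxx => /uW; rewrite inE negb_or => /andP[].
- move=> i j y; rewrite !inE => /predU1P[->|ir] /predU1P[->|jr] //.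
  + by rewrite (s'r j) // {1}/s' eqxx => /(uW' j) -/(_ jr)/negP.
  + by rewrite (s'r i) // /s' eqxx => yi /(uW' i) -/(_ ir)/negP.
  + by rewrite !s'r //; apply: sD.
Qed.

(** These are the nonempty faces of [K_t^(3)]. *)
Definition small (t : nat) (A : {set 'I_t}) : bool := 0 < #|A| <= 3.

Lemma set_card (t : nat) : #|{set 'I_t}| = 2 ^ t.
Proof. by rewrite -cardsT -powersetT card_powerset cardsT card_ord. Qed.

(* [q A] is the vertex placed at the barycentre of the face [A], and [s A k] is the
   interior of a path from [q A] to [q (k |: A)], for an edge [A]. *)
Lemma exists_subdivision (V : finType) (E : {set {set V}}) (t K M ell : nat)
    (v : 'I_t -> V) (U : {set 'I_t} -> {set V}) :
  2 < t -> injective v ->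
  (forall A : {set 'I_t}, #|A| = 3 ->
     K <= #|\bigcap_(B : {set 'I_t} | (B \subset A) && (#|B| == 2)) U B|) ->
  (forall (A : {set 'I_t}) (W : {set V}) (p z : V), #|A| = 2 -> #|W| <= M ->
     p \in U A :\: W -> z \in U A :\: W ->
     exists s, [/\ path (link E (v @: A)) p s, last p s = z,
       {subset s <= U A :\: W}, uniq (p :: s) & size s <= ell]) ->
  t + 2 ^ t < K -> 2 ^ t + 2 ^ t * t * ell <= M ->
  exists (q : {set 'I_t} -> V) (s : {set 'I_t} -> 'I_t -> seq V),
  [/\ forall a, q [set a] = v a,
      forall A B, small A -> small B -> q A = q B -> A = B,
      forall (A : {set 'I_t}) k, #|A| = 2 -> k \notin A ->
        path (link E (v @: A)) (q A) (rcons (s A k) (q (k |: A))) /\ uniq (s A k),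
      forall A k B, small B -> q B \notin s A k &
      forall A k B l y, y \in s A k -> y \in s B l -> A = B /\ k = l].
Proof.
move=> t3 vinj Ubig Upath Kbig Mbig.
(* Candidates for [q A]: for a pair this is [U A], for a triple the intersection of its three
   expanders, so both ends of a leg at a pair [A] lie in [U A]. *)
pose X (A : {set 'I_t}) := \bigcap_(B : {set 'I_t} | (B \subset A) && (#|B| == 2)) U B.
have Xmono (A A' : {set 'I_t}) : A \subset A' -> X A' \subset X A.
  move=> sub; apply/bigcapsP => B /andP[BA B2]; apply: bigcap_inf.
  by rewrite B2 (subset_trans BA sub).
(* Extending a pair to a triple gives the pair at least [K] candidates as well. *)
have ext (A : {set 'I_t}) : #|A| = 2 -> exists k, k \notin A.
  move=> A2; have : ~~ ([set: 'I_t] \subset A).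
    by apply/negP => /subset_leq_card; rewrite cardsT card_ord A2; lia.
  by case/subsetPn => k _ kA; exists k.
have XK (A : {set 'I_t}) : 1 < #|A| <= 3 -> K <= #|X A|.
  case/andP => A1 A3; have [lt|ge] := ltnP #|A| 3; last first.
    by apply: Ubig; lia.
  have A2 : #|A| = 2 by lia.
  have [k kA] := ext A A2.
  apply: (leq_trans (Ubig (k |: A) _)); first by rewrite cardsU1 kA A2.
  by apply: subset_leq_card; apply: Xmono; apply: subsetUr.
have [] := @greedy_disjoint {set 'I_t} V
  (fun A s => 1 < #|A| <= 3 -> exists2 u, s = [:: u] & u \in X A) 1 (t + 2 ^ t)
  (v @: [set: 'I_t]).
- move=> A W _ Wle; have [A13|/negP A13] := boolP (1 < #|A| <= 3); last first.
    by exists [::]; split=> // /A13.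
  have /subsetPn[u uX uW] : ~~ (X A \subset W).
    by apply/negP => /subset_leq_card; have := XK A A13; lia.
  exists [:: u]; split=> //; first by exists u.
  by move=> y; rewrite inE => /eqP ->.
- by rewrite muln1 set_card leq_add2r card_imset // cardsT card_ord.
move=> s0 [s0P s0v s0D].
have t0 : 0 < t by lia.
(* The default of [head] can only be reached for sets that are not faces. *)
pose q (A : {set 'I_t}) := if [pick a | A == [set a]] is Some a then v a
                           else head (v (Ordinal t0)) (s0 A).
have q1 a : q [set a] = v a.
  by rewrite /q; case: pickP => [b /eqP/set1_inj-> //|/(_ a)]; rewrite eqxx.
have q23 (A : {set 'I_t}) : 1 < #|A| <= 3 -> q A \in s0 A /\ q A \in X A.
  move=> A13; have [u su uX] := s0P A A13; rewrite /q su inE.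
  by case: pickP => [b /eqP eq|_]; rewrite ?eqxx // eq cards1 in A13.
have smallP (A : {set 'I_t}) : small A -> (exists a, A = [set a]) \/ 1 < #|A| <= 3.
  rewrite /small; case: (#|A| =P 1) => [/eqP/cards1P[a ->]|ne] lt; first by left; exists a.
  by right; lia.
have qinj A B : small A -> small B -> q A = q B -> A = B.
  move=> /smallP[[a ->]|A13] /smallP[[b ->]|B13]; rewrite ?q1.
  - by move=> /vinj ->.
  - have [qB _] := q23 B B13 => eq; have := s0v _ _ qB.
    by rewrite -eq imset_f.
  - have [qA _] := q23 A A13 => eq; have := s0v _ _ qA.
    by rewrite eq imset_f.
  - have [qA _] := q23 A A13; have [qB _] := q23 B B13 => eq.
    by apply: (s0D _ _ (q A)); rewrite // eq.
have [] := @greedy_disjoint ({set 'I_t} * 'I_t)%type V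
  (fun Ak s => #|Ak.1| = 2 -> Ak.2 \notin Ak.1 ->
        path (link E (v @: Ak.1)) (q Ak.1) (rcons s (q (Ak.2 |: Ak.1))) /\ uniq s)
  ell M (q @: [set: {set 'I_t}]).
- move=> [A k] W W0 Wle /=.
  have [/eqP A2|A2] := boolP (#|A| == 2); last first.
    by exists [::]; split=> // /eqP; rewrite (negPf A2).
  have [kA|kA] := boolP (k \in A); first by exists [::]; split.
  have Ak3 : #|k |: A| = 3 by rewrite cardsU1 kA A2.
  have [_ qA] : q A \in s0 A /\ q A \in X A by apply: q23; rewrite A2.
  have [_ qAk] : q (k |: A) \in s0 (k |: A) /\ q (k |: A) \in X (k |: A).
    by apply: q23; rewrite Ak3.
  pose p := q A; pose z := q (k |: A).
  have pz : p != z.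
    by apply/eqP => /qinj; rewrite /small A2 Ak3 => /(_ isT isT) eq; rewrite -eq A2 in Ak3.
  have UA (B : {set 'I_t}) : A \subset B -> X B \subset U A.
    by move=> AB; apply: bigcap_inf; rewrite AB A2.
  (* The forbidden set contains both ends of the path, so they are released here; simplicity of the
     path keeps its interior off them. *)
  pose W' := W :\: [set p; z].
  have W'le : #|W'| <= M by apply: leq_trans Wle; apply: subset_leq_card; apply: subsetDl.
  have pU : p \in U A :\: W'.
    by rewrite !inE eqxx /=; apply: (subsetP (UA A (subxx _))).
  have zU : z \in U A :\: W'.
    have /subsetP UAk := UA (k |: A) (subsetUr _ _).
    by rewrite in_setD !inE eqxx orbT; apply: UAk.
  have [s [sp sl sU su sz]] := Upath A W' p z A2 W'le pU zU.
  case/lastP: s => [|s y] in sp sl sU su sz; first by rewrite /= in sl; rewrite sl eqxx in pz.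
  rewrite last_rcons in sl; subst y.
  move: su; rewrite /= mem_rcons rcons_uniq inE negb_or => /and3P[/andP[_ ps] zs us].
  exists s; split=> //.
    by rewrite size_rcons in sz; apply: ltnW.
  move=> y ys; have := sU y; rewrite mem_rcons inE ys orbT => /(_ isT).
  rewrite !inE => /andP[+ _]; rewrite negb_and negbK.
  case/orP => // /orP[]/eqP eq; first by rewrite -eq ys in ps.
  by rewrite -eq ys in zs.
- rewrite card_prod set_card card_ord; apply: leq_trans Mbig; rewrite leq_add2r.
  by apply: (leq_trans (leq_imset_card _ _)); rewrite cardsT set_card.
move=> s [sP s0' sD]; exists q, (fun A k => s (A, k)); split=> //.
- by move=> A k A2 kA; apply: (sP (A, k)).
- by move=> A k B _; apply/negP => /s0'; rewrite imset_f.
- by move=> A k B l y yA yB; have [] := sD _ _ _ yA yB.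
Qed.

(** * The subdivided complex *)

(** The part of [exists_subdivision] on which the homeomorphism rests; the hypergraph no longer
    occurs. *)
Definition subdivision (n t : nat) (q : {set 'I_t} -> 'I_n)
    (s : {set 'I_t} -> 'I_t -> seq 'I_n) : Prop :=
  [/\ forall A B, small A -> small B -> q A = q B -> A = B,
      forall (A : {set 'I_t}) k, #|A| = 2 -> k \notin A -> uniq (s A k),
      forall A k B, small B -> q B \notin s A k &
      forall A k B l y, y \in s A k -> y \in s B l -> A = B /\ k = l].

Definition leg_len (n t : nat) (s : {set 'I_t} -> 'I_t -> seq 'I_n)
    (A : {set 'I_t}) (k : 'I_t) : nat := (size (s A k)).+1.

Definition leg (n t : nat) (q : {set 'I_t} -> 'I_n)
    (s : {set 'I_t} -> 'I_t -> seq 'I_n) (A : {set 'I_t}) (k : 'I_t) (l : nat) : 'I_n :=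
  nth (q A) (q A :: rcons (s A k) (q (k |: A))) l.

(** A flag [{i}], [{i, j}], [{i, j, k}], that is, a triangle of the barycentric subdivision. *)
Definition sector (t : nat) (i j k : 'I_t) : bool := (i != j) && (k \notin [set i; j]).

(** Each triangle of the barycentric subdivision becomes the cone from [q [set i]] over a leg. The
    leg depends on [i] and [j] only through [[set i; j]], so the cones from the two ends share
    it. *)
Definition facets (n t : nat) (q : {set 'I_t} -> 'I_n)
    (s : {set 'I_t} -> 'I_t -> seq 'I_n) : {set {set 'I_n}} :=
  [set e | [exists i, exists j, exists k, sector i j k &&
     has (fun l => e == [set leg q s [set i; j] k l; leg q s [set i; j] k l.+1; q [set i]])
       (iota 0 (leg_len s [set i; j] k))]].

Lemma facetsP (n t : nat) (q : {set 'I_t} -> 'I_n)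
    (s : {set 'I_t} -> 'I_t -> seq 'I_n) (e : {set 'I_n}) :
  reflect (exists i j k l, [/\ sector i j k, (l < leg_len s [set i; j] k) &
     e = [set leg q s [set i; j] k l; leg q s [set i; j] k l.+1; q [set i]]])
    (e \in facets q s).
Proof.
rewrite inE; apply: (iffP existsP).
  move=> [i /existsP[j /existsP[k /andP[ijk /hasP[l]]]]].
  by rewrite mem_iota /= add0n => lm /eqP eE; exists i, j, k, l.
move=> [i [j [k [l [ijk lm eE]]]]]; exists i; apply/existsP; exists j; apply/existsP; exists k.
by rewrite ijk andTb; apply/hasP; exists l; rewrite ?mem_iota ?eE.
Qed.


(** * Choice of parameters *)

(** With [j = k %/ m.+1], the inequality [j.+1 <= 2 ^ j] bounds [k ^ m.+1] by a constant times
    [2 ^ k]; the spare factor [k] then beats [c]. *)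
Lemma exp_dominates_poly (c m : nat) : exists k0, forall k, k0 <= k -> c * k ^ m <= 2 ^ k.
Proof.
exists (c * m.+1 ^ m.+1) => k ck.
pose j := k %/ m.+1.
have kj : k <= m.+1 * j.+1 by have := ltn_ceil k (ltn0Sn m); rewrite -/j mulnC; lia.
have e1 : k ^ m.+1 <= m.+1 ^ m.+1 * 2 ^ k.
  apply: (@leq_trans ((m.+1 * j.+1) ^ m.+1)); first by rewrite leq_exp2r.
  rewrite expnMn leq_mul2l; apply/orP; right.
  apply: (@leq_trans ((2 ^ j) ^ m.+1)); first by rewrite leq_exp2r // ltn_expl.
  by rewrite -expnM leq_exp2l // leq_divM.
have m0 : 0 < m.+1 ^ m.+1 by rewrite expn_gt0.
rewrite -(leq_pmul2l m0); apply: leq_trans e1.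
by rewrite (expnS k) mulnA leq_mul2r mulnC ck orbT.
Qed.

(** The density hypothesis is cubed to remain within the natural numbers. *)
Lemma exists_facets_subset (t : nat) : 2 < t ->
  exists C, forall (n : nat) (E : {set {set 'I_n}}),
    (forall e, e \in E -> #|e| = 3) -> C * n ^ 8 < #|E| ^ 3 ->
    exists q s, @subdivision n t q s /\ facets q s \subset E.
Proof.
move=> t3; pose K := t + 2 ^ t + 1.
pose c := 32 * t ^ 2 * 2 ^ t * (1 + 64 * t ^ 3).
have [k0 k0P] := exp_dominates_poly (2 * (c * 27) ^ 3) 9.
(* The term [2 ^ k0] makes [n] large enough for [beta ^ 3 <= n], the second is 64 times the constant
   [2 * t ^ 3 * K] of [exists_good_star], and the last gives [n ^ 2 <= sigma ^ 3]. *)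
exists (2 ^ k0 + 128 * t ^ 3 * K + 64) => n E E3 Ebig.
have En : #|E| <= n ^ 3.
  apply: (leq_trans (sum_codegree_ge E3)).
  apply: (@leq_trans (\sum_(x : 'I_n) \sum_(y : 'I_n) n)).
    apply: leq_sum => x _; apply: leq_sum => y _.
    by rewrite -[leqRHS]card_ord; apply: max_card.
  by rewrite !sum_nat_const !card_ord; lia.
have n0 : 0 < n.
  rewrite lt0n; apply/eqP => nz.
  have /eqP Enil : #|E| == 0 by rewrite -leqn0; apply: (leq_trans En); rewrite nz.
  by move: Ebig; rewrite Enil.
(* As [#|E| <= n ^ 3], the density hypothesis itself forces [n] to be large. *)
have nC : 2 ^ k0 + 128 * t ^ 3 * K + 64 < n.
  rewrite -(ltn_pmul2r (_ : 0 < n ^ 8)) ?expn_gt0 ?n0 //.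
  apply: (leq_trans Ebig); rewrite -expnS.
  by rewrite -[9]/(3 * 3) expnM leq_exp2r.
pose k := (trunc_log 2 n).+1.
have nk : n < 2 ^ k by apply: trunc_log_ltn.
have kn : 2 ^ k <= 2 * n by rewrite expnS leq_mul2l /= trunc_logP.
have kk0 : k0 <= k by rewrite -(@leq_exp2l 2) //; lia.
(* The total weight is at most [2 * n ^ 2], hence below [2 ^ L]. [M] bounds the number of vertices
   to be avoided, and [beta] is the excess weight that [expander_short_path] then requires. *)
pose L := 2 * k + 1; pose Q := 16 * t ^ 2 * L; pose ell := 4 * Q * L.
pose M := 2 ^ t + 2 ^ t * t * ell; pose beta := 2 * Q * M.
have k1 : 0 < k by [].
have bL : beta <= c * L ^ 3.
  have L1 : 1 <= L * L by rewrite muln_gt0 /L; lia.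
  have -> : c * L ^ 3 = 2 * Q * (2 ^ t * ((1 + 64 * t ^ 3) * (L * L))).
    by rewrite /c /Q; lia.
  have -> : beta = 2 * Q * (2 ^ t * (1 + 64 * t ^ 3 * (L * L))).
    by rewrite /beta /M /ell /Q; lia.
  by rewrite leq_mul2l leq_mul2l mulnDl mul1n leq_add2r L1 !orbT.
(* [beta] is of order [L ^ 3], thus polylogarithmic in [n]. *)
have b3 : beta ^ 3 <= n.
  apply: (@leq_trans ((c * (3 * k) ^ 3) ^ 3)).
    rewrite leq_exp2r //; apply: (leq_trans bL); rewrite leq_mul2l leq_exp2r // /L.
    by apply/orP; right; lia.
  have := k0P k kk0.
  have -> : (c * (3 * k) ^ 3) ^ 3 = (c * 27) ^ 3 * k ^ 9.
    by rewrite (expnMn 3) mulnA (expnMn _ (k ^ 3)) -expnM.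
  rewrite -mulnA; move: (_ * k ^ 9) => X; lia.
have b8 : 8 * t ^ 2 <= beta.
  have -> : beta = 8 * t ^ 2 * (4 * (L * M)) by rewrite /beta /Q; lia.
  by apply: leq_pmulr; rewrite !muln_gt0 /L /M addn1 ltn_addr ?expn_gt0.
have b0 : 0 < beta by apply: leq_trans b8; rewrite muln_gt0 expn_gt0; lia.
have bn : beta <= n by apply: leq_trans b3; rewrite -[leqLHS]expn1 leq_pexp2l.
(* At least of order [n^(2/3)]. Once [sigma] is positive, [sigma.+1 <= 2 * sigma] absorbs the
   rounding. *)
pose sigma := #|E| %/ (2 * n ^ 2).
have Esig : 2 * sigma * n ^ 2 <= #|E|.
  by apply: leq_trans (leq_divM #|E| (2 * n ^ 2)); rewrite -/sigma; lia.
have n2 : 0 < 2 * n ^ 2 by rewrite muln_gt0 expn_gt0 n0.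
have Elt : #|E| < sigma.+1 * (2 * n ^ 2) by apply: ltn_ceil.
have s0 : 0 < sigma.
  rewrite divn_gt0 // -(@leq_exp2r _ _ 3) //; apply: ltnW; apply: leq_trans Ebig.
  rewrite ltnS expnMn -expnM; apply: leq_mul; first by lia.
  by rewrite leq_pexp2l.
have C64 : (2 ^ k0 + 128 * t ^ 3 * K + 64) * n ^ 2 < 64 * sigma ^ 3.
  rewrite -(ltn_pmul2r (_ : 0 < n ^ 6)) ?expn_gt0 ?n0 // -mulnA -expnD.
  apply: (leq_trans Ebig).
  have -> : 64 * sigma ^ 3 * n ^ 6 = (4 * sigma * n ^ 2) ^ 3.
    by lia.
  rewrite leq_exp2r //; apply: ltnW; apply: (leq_trans Elt).
  by rewrite mulnCA mulnA; apply: leq_mul => //; lia.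
(* After cubing, [beta ^ 3 <= n] reduces this to [n ^ 4 <= sigma ^ 6]. *)
have sb : n * beta <= sigma ^ 2.
  rewrite -(@leq_exp2r _ _ 3) // expnMn -expnM.
  have n2s : n ^ 2 <= sigma ^ 3.
    rewrite -(leq_pmul2l (isT : 0 < 64)); apply: ltnW; apply: leq_ltn_trans C64.
    by rewrite leq_mul2r leq_addl orbT.
  apply: (@leq_trans ((n ^ 2) ^ 2)); last by rewrite -[2 * 3]/(3 * 2) (expnM sigma) leq_exp2r.
  by rewrite (_ : (n ^ 2) ^ 2 = n ^ 3 * n) ?leq_mul2l ?b3 ?orbT //; lia.
have sK : 2 * t ^ 3 * K * n ^ 2 < sigma ^ 3.
  rewrite -(ltn_pmul2l (isT : 0 < 64)); apply: leq_ltn_trans C64.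
  by rewrite mulnA leq_mul2r; apply/orP; right; lia.
pose w S (x : 'I_n) := #|[set y | link E S x y]| + beta.
have w0 S x : 0 < w S x by rewrite /w; lia.
have wL S : weight (w S) [set: 'I_n] < 2 ^ L.
  apply: (@leq_ltn_trans (\sum_(x : 'I_n) (n + beta))).
    rewrite /weight big_mkcond; apply: leq_sum => x _; rewrite inE leq_add2r.
    by rewrite -[leqRHS]card_ord; apply: max_card.
  rewrite sum_nat_const card_ord.
  have -> : 2 ^ L = 2 * (2 ^ k * 2 ^ k) by rewrite /L addn1 expnS (mul2n k) -addnn expnD.
  have := ltn_mul nk nk.
  have : n * (n + beta) <= n * (n + n) by rewrite leq_mul2l leq_add2l bn orbT.
  rewrite mulnDr; lia.
have /fin_all_exists[lab labP] : forall S, exists lab : 'I_n -> {set 'I_n},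
    [/\ forall x, x \in [set: 'I_n] -> (x \in lab x) && (lab x \subset [set: 'I_n]),
        forall x y, x \in [set: 'I_n] -> y \in lab x -> lab y = lab x,
        forall x, x \in [set: 'I_n] -> expander (link E S) (w S) Q (lab x) &
        Q * (\sum_(x in [set: 'I_n]) #|[set y in [set: 'I_n] |
            link E S x y && (y \notin lab x)]|) <= 2 * (weight (w S) [set: 'I_n] * L)].
  by move=> S; apply: expander_partition => //; apply: link_sym.
have [x [v [vinj vK]]] : exists (x : 'I_n) (v : 'I_t -> 'I_n), injective v /\
    forall a b c, a != b -> a != c -> b != c ->
      K <= #|lab [set v a; v b] x :&: lab [set v b; v c] x :&: lab [set v a; v c] x|.
  apply: (@exists_good_star _ E t K Q L beta sigma lab); rewrite ?card_ord //.
  - by move=> S x y; have [_ H _ _] := labP S; apply: H.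
  - move=> S; have [_ _ _] := labP S.
    have sumT (F : 'I_n -> nat) : \sum_(y in [set: 'I_n]) F y = \sum_y F y.
      by apply: eq_bigl => y; rewrite inE.
    rewrite /weight !sumT; apply: leq_trans; rewrite leq_mul2l; apply/orP; right.
    apply: leq_sum => x _.
    by apply: subset_leq_card; apply/subsetP => y; rewrite !inE.
  - by rewrite /L; lia.
have im2 (a b : 'I_t) : v @: [set a; b] = [set v a; v b] by rewrite imsetU1 imset_set1.
have [||||q [s [q1 qinj spath savoid sdisj]]] :=
  @exists_subdivision _ E t K M ell v (fun A => lab (v @: A) x) t3 vinj.
- move=> A A3.
  have /card_gt0P[a aA] : 0 < #|A| by rewrite A3.
  have : #|A :\ a| == 2 by move: A3; rewrite (cardsD1 a) aA add1n => -[->].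
  case/cards2P => b [d [bd Ae]].
  have bA : b \in A :\ a by rewrite Ae !inE eqxx.
  have dA : d \in A :\ a by rewrite Ae !inE eqxx orbT.
  move: bA dA; rewrite !inE => /andP[ba bA] /andP[da dA].
  apply: (leq_trans (vK a b d _ _ bd)); rewrite 1?eq_sym //.
  apply: subset_leq_card; apply/bigcapsP => B /andP[BA /cards2P[p [r [pr Be]]]].
  have inA y : y \in B -> [|| y == a, y == b | y == d].
    by move=> /(subsetP BA); rewrite -(setD1K aA) Ae !inE.
  have := inA p; have := inA r; rewrite Be !inE !eqxx orbT => /(_ isT) rA /(_ isT) pA.
  rewrite im2; apply/subsetP => y; rewrite !inE => /andP[/andP[y1 y2] y3].
  move: pr; case/or3P: pA => /eqP->; case/or3P: rA => /eqP->; rewrite ?eqxx // => _;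
    by rewrite // setUC.
- move=> A W p z A2 WM pU zU; apply: (@expander_short_path _ _ (w (v @: A)) Q M L) => //.
  + exact: link_sym.
  + by have [_ _ H _] := labP (v @: A); apply: H.
  + by apply: leq_ltn_trans (wL (v @: A)); apply: weight_le; apply: subsetT.
- by rewrite /K; lia.
- by [].
exists q, s; split; first by split=> // A h A2 hA; have [] := spath A h A2 hA.
(* Consecutive vertices of a leg are adjacent in the graph of [v i] and [v j], so they form an edge
   of [E] with the apex [v i]. *)
apply/subsetP => e /facetsP[i [j [h [l [/andP[ij hij] lm ->]]]]].
have A2 : #|[set i; j]| = 2 by rewrite cards2 ij.
have [/(pathP (q [set i; j])) path_ij _] := spath _ h A2 hij.
have := path_ij l; rewrite size_rcons => /(_ lm) /forall_inP/(_ (v i)).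
by rewrite q1; apply; apply: imset_f; rewrite !inE eqxx.
Qed.

(* Imported only here: many names of [classical_sets] shadow those of [finset]. *)
From mathcomp Require Import all_order all_algebra.
From mathcomp Require Import all_classical all_reals all_analysis.
From mathcomp Require Import ring lra.
Import Order.TTheory GRing.Theory Num.Theory.
Import numFieldNormedType.Exports.
Local Open Scope ring_scope.

(** * Geometric realization *)

Local Open Scope classical_set_scope.

Lemma continuous_sum (T : topologicalType) (K : numFieldType) (V : normedModType K)
    (I : Type) (r : seq I) (f : I -> T -> V) :
  (forall i, continuous (f i)) -> continuous (fun x => \sum_(i <- r) f i x).
Proof.
move=> fc; elim: r => [|i r IH].
  by under [X in continuous X]funext => x do rewrite big_nil; move=> x; exact: cvg_cst.
under [X in continuous X]funext => x do rewrite big_cons.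
by move=> x; apply: cvgD; [exact: fc | exact: IH].
Qed.

(** It is closed in the unit cube: the support condition is a finite union, over the edges, of
    closed conditions. *)
Lemma realization_compact (R : realType) (n : nat) (F : {set {set 'I_n}}) :
  compact (@realization R n F).
Proof.
pose cube := [set x : 'rV[R]_n | forall i, `[0, 1]%classic (x ord0 i)].
have cc : compact cube.
  by apply: (@rV_compact R n (fun=> `[0, 1]%classic)) => i; exact: segment_compact.
have sub : @realization R n F `<=` cube.
  move=> x [x0 [x1 _]] i /=; rewrite in_itv /= x0 /= -x1 (bigD1 i) //= lerDl.
  by apply: sumr_ge0.
apply: (subclosed_compact _ cc sub).
have -> : @realization R n F =
   (\bigcap_(i in [set: 'I_n]) ((fun x : 'rV[R]_n => x ord0 i) @^-1` [set y | 0 <= y])) `&`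
   (((fun x : 'rV[R]_n => \sum_i x ord0 i) @^-1` [set y | y = 1]) `&`
   \big[setU/set0]_(e <- enum F) \bigcap_(i in [set i | i \notin e])
     ((fun x : 'rV[R]_n => x ord0 i) @^-1` [set y | y = 0])).
  apply/seteqP; split => x.
    move=> [x0 [x1 [e eF xe]]]; split; first by move=> i _; exact: x0.
    split=> //; rewrite -bigcup_seq; exists e; first by rewrite /= mem_enum.
    by move=> i /= ie; apply/eqP/negPn/negP => /xe; rewrite (negPf ie).
  move=> [x0 [x1]]; rewrite -bigcup_seq => -[e /=]; rewrite mem_enum => eF xe.
  split; first by move=> i; exact: x0.
  split=> //; exists e => // i; apply: contraNT => ie; apply/eqP; exact: xe.
have cont i : continuous (fun x : 'rV[R]_n => x ord0 i) by exact: coord_continuous.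
apply: closedI.
  apply: closed_bigI => i _; apply: preimage_closed; last exact: closed_ge.
  by move=> x _; exact: cont.
apply: closedI.
  apply: preimage_closed; last exact: closed_eq.
  by move=> x _; apply: (@continuous_sum _ R R^o) => i; exact: cont.
apply: closed_bigsetU => e _; apply: closed_bigI => i _.
by apply: preimage_closed; [move=> x _; exact: cont | exact: closed_eq].
Qed.

(** The preimage of a closed set under the inverse is the image of a compact set, hence closed. *)
Lemma compact_bijection_homeomorphic (R : realType) (m k : nat)
    (A : set 'rV[R]_m) (B : set 'rV[R]_k) (f : 'rV[R]_m -> 'rV[R]_k) :
  compact A -> continuous f -> (forall x, A x -> B (f x)) ->
  (forall x y, A x -> A y -> f x = f y -> x = y) ->
  (forall y, B y -> exists2 x, A x & f x = y) ->
  homeomorphic A B.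
Proof.
move=> cA cf fAB finj fsurj.
pose g y := xget (0 : 'rV[R]_m) [set x | A x /\ f x = y].
have gP y : B y -> A (g y) /\ f (g y) = y.
  move=> By; rewrite /g; case: xgetP => [x _ //|none].
  by have [x Ax fx] := fsurj y By; case: (none x).
exists f, g; split; first exact: continuous_subspaceT.
split; last first.
  split=> //; split; first by move=> y /gP[].
  split; last by move=> y /gP[].
  by move=> x Ax; have [Ag fg] := gP _ (fAB x Ax); apply: finj.
apply/continuous_closedP => C cC; apply/closed_subspaceP.
exists (f @` (A `&` C)); last first.
  apply/seteqP; split => y [] /=.
    move=> [x [Ax Cx] <-] By; split=> //; have [Ag fg] := gP _ By.
    by rewrite /from_subspace (finj _ _ Ag Ax fg).
  by move=> Cy By; split=> //; have [Ag fg] := gP _ By; exists (g y).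
apply: compact_closed; first exact: norm_hausdorff.
apply: continuous_compact; first exact: continuous_subspaceT.
exact: compact_closedI.
Qed.

Local Close Scope classical_set_scope.

(** * Vertices of the legs *)

Lemma sector_cards (t : nat) (i j k : 'I_t) : sector i j k ->
  [/\ #|[set i]| = 1%N, #|[set i; j]| = 2%N & #|k |: [set i; j]| = 3%N].
Proof.
by move=> /andP[ij kij]; rewrite cards1 cards2 ij (cardsU1 k) kij cards2 ij.
Qed.

Lemma sector_small (t : nat) (i j k : 'I_t) : sector i j k ->
  [/\ small [set i], small [set i; j] & small (k |: [set i; j])].
Proof. by rewrite /small => /sector_cards[-> -> ->]. Qed.

Lemma leg_inj (n t : nat) (q : {set 'I_t} -> 'I_n)
    (s : {set 'I_t} -> 'I_t -> seq 'I_n) (A : {set 'I_t}) (k : 'I_t) (l h : nat) :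
  subdivision q s -> #|A| = 2%N -> k \notin A ->
  (l <= leg_len s A k)%N -> (h <= leg_len s A k)%N ->
  leg q s A k l = leg q s A k h -> l = h.
Proof.
move=> [qinj suniq savoid _] A2 kA lm hm /eqP.
have sA : small A by rewrite /small A2.
have sAk : small (k |: A) by rewrite /small cardsU1 kA A2.
rewrite nth_uniq /= ?size_rcons ?ltnS //; first by move/eqP.
rewrite mem_rcons inE negb_or savoid // rcons_uniq savoid // suniq // !andbT.
apply/eqP => /(qinj _ _ sA sAk) eq; have /setP/(_ k) := eq.
by rewrite !inE eqxx (negPf kA).
Qed.

Lemma leg_center (n t : nat) (q : {set 'I_t} -> 'I_n)
    (s : {set 'I_t} -> 'I_t -> seq 'I_n) (A : {set 'I_t}) (k : 'I_t) :
  leg q s A k (leg_len s A k) = q (k |: A).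
Proof. by rewrite /leg /leg_len /= nth_rcons ltnn eqxx. Qed.

Lemma leg_interior (n t : nat) (q : {set 'I_t} -> 'I_n)
    (s : {set 'I_t} -> 'I_t -> seq 'I_n) (A : {set 'I_t}) (k : 'I_t) (l : nat) :
  (0 < l < leg_len s A k)%N -> leg q s A k l = nth (q A) (s A k) l.-1.
Proof. by case: l => // l; rewrite /leg /leg_len /= ltnS nth_rcons => ->. Qed.

Lemma leg_vertex (n t : nat) (q : {set 'I_t} -> 'I_n)
    (s : {set 'I_t} -> 'I_t -> seq 'I_n) (A : {set 'I_t}) (k : 'I_t) (l : nat) :
  (l <= leg_len s A k)%N ->
  [\/ leg q s A k l = q A, leg q s A k l = q (k |: A) | leg q s A k l \in s A k].
Proof.
case: l => [|l lm]; first by constructor 1.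
have [lt|ge] := ltnP l.+1 (leg_len s A k).
  by constructor 3; rewrite leg_interior //; apply: mem_nth.
constructor 2; rewrite -(leg_center q s); congr (leg _ _ _ _ _).
by apply/eqP; rewrite eqn_leq lm.
Qed.

Lemma leg_not_apex (n t : nat) (q : {set 'I_t} -> 'I_n)
    (s : {set 'I_t} -> 'I_t -> seq 'I_n) (i j k : 'I_t) (l : nat) :
  subdivision q s -> sector i j k -> (l <= leg_len s [set i; j] k)%N ->
  leg q s [set i; j] k l != q [set i].
Proof.
move=> [qinj _ savoid _] ijk lm; have [c1 c2 c3] := sector_cards ijk.
have [s1 s2 s3] := sector_small ijk.
apply/eqP => eq; have := leg_vertex q lm; rewrite eq => -[/qinj|/qinj|].
- by move=> /(_ s1 s2) eq'; rewrite -eq' c1 in c2.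
- by move=> /(_ s1 s3) eq'; rewrite -eq' c1 in c3.
- by apply/negP; apply: savoid.
Qed.

(** * The simplexwise linear map onto [K_t^(3)] *)

Definition bary (R : realType) (t : nat) (A : {set 'I_t}) : 'rV[R]_t :=
  \row_a (if a \in A then #|A|%:R^-1 else 0).

(* The interior vertices of a leg are equally spaced between the barycentres of [A] and
   [k |: A]. *)
Definition pos (R : realType) (n t : nat) (q : {set 'I_t} -> 'I_n)
    (s : {set 'I_t} -> 'I_t -> seq 'I_n) (u : 'I_n) : 'rV[R]_t :=
  if [pick A | small A && (q A == u)] is Some A then bary R A
  else if [pick Ak | u \in s Ak.1 Ak.2] is Some Ak then
    let r := (index u (s Ak.1 Ak.2)).+1%:R / (leg_len s Ak.1 Ak.2)%:R in
    (1 - r) *: bary R Ak.1 + r *: bary R (Ak.2 |: Ak.1)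
  else 0.

Lemma pos_bary (R : realType) (n t : nat) (q : {set 'I_t} -> 'I_n)
    (s : {set 'I_t} -> 'I_t -> seq 'I_n) (A : {set 'I_t}) :
  subdivision q s -> small A -> pos R q s (q A) = bary R A.
Proof.
move=> [qinj _ _ _] sA; rewrite /pos; case: pickP => [B /andP[sB /eqP/qinj-> //]|/(_ A)].
by rewrite sA eqxx.
Qed.

Lemma pos_leg (R : realType) (n t : nat) (q : {set 'I_t} -> 'I_n)
    (s : {set 'I_t} -> 'I_t -> seq 'I_n) (A : {set 'I_t}) (k : 'I_t) (l : nat) :
  subdivision q s -> #|A| = 2%N -> k \notin A -> (l <= leg_len s A k)%N ->
  let r := l%:R / (leg_len s A k)%:R in
  pos R q s (leg q s A k l) = (1 - r) *: bary R A + r *: bary R (k |: A).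
Proof.
move=> sd A2 kA lm /=; have [qinj suniq savoid sdisj] := sd.
have sA : small A by rewrite /small A2.
have sAk : small (k |: A) by rewrite /small cardsU1 kA A2.
case: l => [|l] in lm *.
  by rewrite mul0r subr0 scale1r scale0r addr0; apply: pos_bary.
have [lt|ge] := ltnP l.+1 (leg_len s A k); last first.
  have -> : l.+1 = leg_len s A k by apply/eqP; rewrite eqn_leq lm.
  by rewrite leg_center pos_bary // divff ?pnatr_eq0 // subrr scale0r scale1r add0r.
have lt' : (l < size (s A k))%N by [].
rewrite leg_interior //= /pos; set u := nth _ _ _.
have us : u \in s A k by apply: mem_nth.
case: pickP => [B /andP[sB /eqP eq]|_].
  by have := savoid A k B sB; rewrite eq us.
case: pickP => [[B h] /= uB|/(_ (A, k))]; last by rewrite /= us.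
by have [<- <-] := sdisj _ _ _ _ _ us uB; rewrite /u index_uniq // suniq.
Qed.

(** Mass [lam] sits at the apex and mass [S] on the leg; for [S] nonzero, [tau / S] is the relative
    position on the leg of the centre of the latter mass. *)
Definition sector_point (R : realType) (t : nat) (i j k : 'I_t) (lam S tau : R) : 'rV[R]_t :=
  lam *: bary R [set i] + (S - tau) *: bary R [set i; j] + tau *: bary R (k |: [set i; j]).

Lemma sector_pointE (R : realType) (t : nat) (i j k : 'I_t) (lam S tau : R) (a : 'I_t) :
  sector i j k ->
  sector_point i j k lam S tau ord0 a =
    if a == i then lam + ((S - tau) / 2 + tau / 3)
    else if a == j then (S - tau) / 2 + tau / 3
    else if a == k then tau / 3 else 0.
Proof.
move=> ijk; have [c1 c2 c3] := sector_cards ijk.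
rewrite !mxE c1 c2 c3 !inE invr1; move: ijk; rewrite /sector !inE negb_or.
move=> /and3P[ij ki kj].
have [->|ai] := eqVneq a i; first by rewrite orbT /= mulr1 addrA.
have [->|aj] := eqVneq a j; first by rewrite !orbT /= mulr0 add0r.
by rewrite /= orbF; case: ifP => _; rewrite !mulr0 ?add0r ?addr0.
Qed.

(* The coordinates of a point of the sector [x_i >= x_j >= x_k] determine its
   barycentric weights and, whenever the corresponding weight is nonzero, the face. *)
Lemma sector_point_inj (R : realType) (t : nat) (i j k i' j' k' : 'I_t)
    (lam S tau lam' S' tau' : R) :
  sector i j k -> sector i' j' k' ->
  0 <= lam -> 0 <= tau <= S -> lam + S = 1 ->
  0 <= lam' -> 0 <= tau' <= S' -> lam' + S' = 1 ->
  sector_point i j k lam S tau = sector_point i' j' k' lam' S' tau' ->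
  [/\ lam = lam', tau = tau', 0 < lam -> i = i',
      tau < S -> [set i; j] = [set i'; j'] &
      0 < tau -> k |: [set i; j] = k' |: [set i'; j']].
Proof.
move=> ijk ijk' l0 /andP[t0 tS] lS l0' /andP[t0' tS'] lS' eqp.
have E a : sector_point i j k lam S tau ord0 a =
    sector_point i' j' k' lam' S' tau' ord0 a by rewrite eqp.
have F := fun a => sector_pointE lam S tau a ijk.
have F' := fun a => sector_pointE lam' S' tau' a ijk'.
have ij : j == i = false by apply/negbTE; rewrite eq_sym; case/andP: ijk.
have ij' : j' == i' = false by apply/negbTE; rewrite eq_sym; case/andP: ijk'.
pose A := (S - tau) / 2 + tau / 3; pose B := tau / 3.
pose A' := (S' - tau') / 2 + tau' / 3;
have ci : sector_point i j k lam S tau ord0 i = lam + A by rewrite F eqxx.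
have cj : sector_point i j k lam S tau ord0 j = A by rewrite F ij eqxx.
have ci' : sector_point i j k lam S tau ord0 i' = lam' + A' by rewrite E F' eqxx.
have cj' : sector_point i j k lam S tau ord0 j' = A' by rewrite E F' ij' eqxx.
(* [lam + A] is the largest coordinate and [A] the largest one away from [i]; the same holds for the
   primed data. *)
have maxi a : sector_point i j k lam S tau ord0 a <= lam + A.
  by rewrite F /A; case: ifP => _; [|case: ifP => _; [|case: ifP => _]]; lra.
have maxj a : a != i -> sector_point i j k lam S tau ord0 a <= A.
  by move=> /negbTE ai; rewrite F ai /A; case: ifP => _; [|case: ifP => _]; lra.
have maxi' a : sector_point i j k lam S tau ord0 a <= lam' + A'.
  by rewrite E F' /A'; case: ifP => _; [|case: ifP => _; [|case: ifP => _]]; lra.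
have maxj' a : a != i' -> sector_point i j k lam S tau ord0 a <= A'.
  by move=> /negbTE ai; rewrite E F' ai /A'; case: ifP => _; [|case: ifP => _]; lra.
(* If the apexes differ, adding the two bounds gives [lam + lam' <= 0]. *)
have [ll li] : lam = lam' /\ (0 < lam -> i = i').
  have m1 := maxi i'; have m2 := maxi' i; rewrite ci' in m1; rewrite ci in m2.
  have [eqi|nei] := eqVneq i i'.
    split=> //; have ji' : j != i' by rewrite -eqi ij.
    have ji : j' != i by rewrite eqi ij'.
    have := maxj' j ji'; have := maxj j' ji; rewrite cj cj'; lra.
  have := maxj i'; rewrite eq_sym => /(_ nei); have := maxj' i nei.
  rewrite ci ci' => ? ?; split; first by lra.
  by move=> ?; exfalso; lra.
have AA : A = A' by have := maxi i'; have := maxi' i; rewrite ci ci'; lra.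
have tt : tau = tau' by move: AA; rewrite /A /A'; lra.
have SS : S = S' by lra.
split=> // lt.
(* For [tau < S], the coordinates above [tau / 3] are exactly those at [i] and [j]. *)
- have top a : (B < sector_point i j k lam S tau ord0 a) = (a \in [set i; j]).
    rewrite F !inE /B; case: ifP => _ /=; first by apply/idP; lra.
    case: ifP => _ /=; first by apply/idP; lra.
    by case: ifP => _; apply/negbTE; rewrite -leNgt; lra.
  have top' a : (B < sector_point i j k lam S tau ord0 a) = (a \in [set i'; j']).
    rewrite E F' !inE /B; case: ifP => _ /=; first by apply/idP; lra.
    case: ifP => _ /=; first by apply/idP; lra.
    by case: ifP => _; apply/negbTE; rewrite -leNgt; lra.
  by apply/setP => a; rewrite -top top'.
(* For [0 < tau], the support is the whole triple. *)
- have top a : (0 < sector_point i j k lam S tau ord0 a) = (a \in k |: [set i; j]).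
    rewrite F !inE [RHS]orbC; case: ifP => _ /=; first by apply/idP; lra.
    case: ifP => _ /=; first by apply/idP; lra.
    by case: ifP => _; [apply/idP; lra | rewrite ltxx].
  have top' a : (0 < sector_point i j k lam S tau ord0 a) = (a \in k' |: [set i'; j']).
    rewrite E F' !inE [RHS]orbC; case: ifP => _ /=; first by apply/idP; lra.
    case: ifP => _ /=; first by apply/idP; lra.
    by case: ifP => _; [apply/idP; lra | rewrite ltxx].
  by apply/setP => a; rewrite -top top'.
Qed.

Definition pos_map (R : realType) (n t : nat) (q : {set 'I_t} -> 'I_n)
    (s : {set 'I_t} -> 'I_t -> seq 'I_n) (x : 'rV[R]_n) : 'rV[R]_t :=
  \sum_u x ord0 u *: pos R q s u.

Definition unit_row (R : realType) (n : nat) (u : 'I_n) : 'rV[R]_n := delta_mx ord0 u.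

Definition facet_point (R : realType) (n t : nat) (q : {set 'I_t} -> 'I_n)
    (s : {set 'I_t} -> 'I_t -> seq 'I_n) (i j k : 'I_t) (l : nat) (lam a b : R) : 'rV[R]_n :=
  lam *: unit_row R (q [set i]) + a *: unit_row R (leg q s [set i; j] k l)
    + b *: unit_row R (leg q s [set i; j] k l.+1).

(** As the vertices of a leg are equally spaced, the image depends on the masses [a] and [b] only
    through their sum and their mean position. *)
Lemma pos_map_facet_point (R : realType) (n t : nat) (q : {set 'I_t} -> 'I_n)
    (s : {set 'I_t} -> 'I_t -> seq 'I_n) (i j k : 'I_t) (l : nat) (lam a b : R) :
  subdivision q s -> sector i j k -> (l < leg_len s [set i; j] k)%N ->
  pos_map q s (facet_point q s i j k l lam a b) =
  sector_point i j k lam (a + b) ((a * l%:R + b * l.+1%:R) / (leg_len s [set i; j] k)%:R).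
Proof.
move=> sd ijk lm; have [s1 s2 s3] := sector_small ijk; have [c1 c2 c3] := sector_cards ijk.
have kij : k \notin [set i; j] by case/andP: ijk.
have lin u (c : R) : \sum_w (c *: unit_row R u) ord0 w *: pos R q s w = c *: pos R q s u.
  rewrite (bigD1 u) //= big1 ?addr0; first by rewrite !mxE !eqxx mulr1.
  by move=> w /negbTE wu; rewrite !mxE wu andbF mulr0 scale0r.
rewrite /pos_map /facet_point.
under eq_bigr => w _ do rewrite 2!mxE !scalerDl.
rewrite !big_split /= !lin pos_bary // !pos_leg // ?(ltnW lm) //.
rewrite /sector_point; set m := (leg_len _ _ _)%:R.
have m0 : m != 0 by rewrite pnatr_eq0.
move: (bary R [set i]) (bary R [set i; j]) (bary R (k |: [set i; j])) => X Y Z.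
by apply/rowP => w; rewrite !mxE; field.
Qed.

Lemma facet_point_coord (R : realType) (n t : nat) (q : {set 'I_t} -> 'I_n)
    (s : {set 'I_t} -> 'I_t -> seq 'I_n) (i j k : 'I_t) (l : nat) (lam a b : R) (u : 'I_n) :
  facet_point q s i j k l lam a b ord0 u =
  lam * (u == q [set i])%:R + a * (u == leg q s [set i; j] k l)%:R
    + b * (u == leg q s [set i; j] k l.+1)%:R.
Proof. by rewrite !mxE. Qed.

Lemma sum_facet_point (R : realType) (n t : nat) (q : {set 'I_t} -> 'I_n)
    (s : {set 'I_t} -> 'I_t -> seq 'I_n) (i j k : 'I_t) (l : nat) (lam a b : R) :
  \sum_u facet_point q s i j k l lam a b ord0 u = lam + a + b.
Proof.
have sum1 (w : 'I_n) (c : R) : \sum_u c * (u == w)%:R = c.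
  rewrite (bigD1 w) //= eqxx mulr1 big1 ?addr0 // => u /negbTE ->.
  by rewrite mulr0.
under eq_bigr => u _ do rewrite facet_point_coord.
by rewrite !big_split /= !sum1.
Qed.

Lemma realization_facetsP (R : realType) (n t : nat) (q : {set 'I_t} -> 'I_n)
    (s : {set 'I_t} -> 'I_t -> seq 'I_n) (x : 'rV[R]_n) :
  subdivision q s ->
  realization (facets q s) x <->
  exists i j k l lam a b, [/\ sector i j k, (l < leg_len s [set i; j] k)%N,
    [/\ 0 <= lam, 0 <= a & 0 <= b], lam + (a + b) = 1 &
    x = facet_point q s i j k l lam a b].
Proof.
move=> sd; split.
  move=> [x0 [x1 [e /facetsP[i [j [k [l [ijk lm ->]]]]] xe]]].
  have kij : k \notin [set i; j] by case/andP: ijk.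
  have [c1 c2 c3] := sector_cards ijk.
  pose lam := x ord0 (q [set i]); pose a := x ord0 (leg q s [set i; j] k l).
  pose b := x ord0 (leg q s [set i; j] k l.+1).
  have xE : x = facet_point q s i j k l lam a b.
    apply/rowP => u; rewrite -[X in x X u]/ord0 -[X in _ = _ X u]/ord0 facet_point_coord.
    have n1 := leg_not_apex sd ijk (ltnW lm); have n2 := leg_not_apex sd ijk lm.
    have n3 : leg q s [set i; j] k l != leg q s [set i; j] k l.+1.
      by apply/eqP => /(leg_inj sd c2 kij (ltnW lm) lm); lia.
    have [->|u1] := eqVneq u (q [set i]).
      by rewrite eq_sym (negbTE n1) eq_sym (negbTE n2) mulr1 !mulr0 !addr0.
    have [->|u2] := eqVneq u (leg q s [set i; j] k l).
      by rewrite (negbTE n3) mulr1 !mulr0 add0r addr0.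
    have [->|u3] := eqVneq u (leg q s [set i; j] k l.+1).
      by rewrite mulr1 !mulr0 !add0r.
    rewrite !mulr0 !addr0; apply/eqP; apply: contraT => /xe.
    by rewrite !inE (negbTE u1) (negbTE u2) (negbTE u3).
  exists i, j, k, l, lam, a, b; split=> //; first by split; exact: x0.
  by rewrite addrA -(sum_facet_point q s i j k l lam a b) -xE.
move=> [i [j [k [l [lam [a [b [ijk lm [l0 a0 b0] sum1 ->]]]]]]]].
split.
  by move=> u; rewrite facet_point_coord !addr_ge0 ?mulr_ge0.
split; first by rewrite sum_facet_point -addrA.
exists [set leg q s [set i; j] k l; leg q s [set i; j] k l.+1; q [set i]].
  by apply/facetsP; exists i, j, k, l.
move=> u; rewrite facet_point_coord !inE; apply: contraR; rewrite !negb_or.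
by move=> /andP[/andP[/negbTE -> /negbTE ->] /negbTE ->]; rewrite !mulr0 !addr0.
Qed.

(* The two edges of the path can differ only if all the mass sits at one vertex. *)
Lemma consecutive_masses (R : realType) (V : lmodType R) (p : nat -> V) (l h : nat)
    (a b a' b' : R) :
  0 <= a -> 0 <= b -> 0 <= a' -> 0 <= b' -> a + b = a' + b' ->
  a * l%:R + b * l.+1%:R = a' * h%:R + b' * h.+1%:R ->
  a *: p l + b *: p l.+1 = a' *: p h + b' *: p h.+1.
Proof.
wlog lh : l h a b a' b' / (l <= h)%N.
  move=> W a0 b0 a0' b0' e1 e2; have [lh|hl] := leqP l h; first exact: W.
  by symmetry; apply: (W _ _ _ _ _ _ (ltnW hl)) => //; symmetry.
move=> a0 b0 a0' b0' e1 e2.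
have [eq|ne] := eqVneq l h.
  rewrite -eq in e2 *; rewrite -natr1 in e2.
  have bb : b = b' by nra.
  have -> : a = a' by lra.
  by rewrite bb.
have [d hE] : exists d, h = (l + d).+1 by exists (h - l.+1)%N; lia.
subst h; rewrite -!natr1 natrD in e2; have d0 : 0 <= (d%:R : R) by rewrite ler0n.
(* Comparing first moments about the position [l + 1] leaves a vanishing sum of nonnegative
   terms. *)
have key : a + b * 0 + (a' * d%:R + b' * (d%:R + 1)) = 0 by nra.
have a'd : 0 <= a' * d%:R by rewrite mulr_ge0.
have b'd : 0 <= b' * d%:R by rewrite mulr_ge0.
have az : a = 0 by lra.
have bz : b' = 0 by lra.
have a'dz : a' * d%:R = 0 by lra.
have ba : b = a' by lra.
rewrite az bz ba !scale0r add0r addr0.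
move/eqP: a'dz; rewrite mulf_eq0 pnatr_eq0 => /orP[/eqP->|/eqP->]; first by rewrite !scale0r.
by rewrite addn0.
Qed.

Lemma continuous_pos_map (R : realType) (n t : nat) (q : {set 'I_t} -> 'I_n)
    (s : {set 'I_t} -> 'I_t -> seq 'I_n) :
  continuous (@pos_map R n t q s).
Proof.
apply: (@continuous_sum _ R 'rV[R]_t) => u x.
have cu := @coord_continuous R 1 n ord0 u x.
exact: (cvgZr_tmp (a := pos R q s u) cu).
Qed.

Lemma sum_bary (R : realType) (t : nat) (A : {set 'I_t}) :
  (0 < #|A|)%N -> \sum_a bary R A ord0 a = 1.
Proof.
move=> A0; under eq_bigr => a _ do rewrite mxE.
by rewrite -big_mkcond /= sumr_const -[_^-1 *+ _]mulr_natl mulfV // pnatr_eq0 -lt0n.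
Qed.

Lemma sum_sector_point (R : realType) (t : nat) (i j k : 'I_t) (lam S tau : R) :
  sector i j k -> \sum_a sector_point i j k lam S tau ord0 a = lam + S.
Proof.
move=> /sector_cards[c1 c2 c3]; rewrite /sector_point.
have := @sum_bary R t [set i]; have := @sum_bary R t [set i; j].
have := @sum_bary R t (k |: [set i; j]); rewrite c1 c2 c3.
move: (bary R [set i]) (bary R [set i; j]) (bary R (k |: [set i; j])) => X Y Z.
move=> /(_ isT) sZ /(_ isT) sY /(_ isT) sX; under eq_bigr => a _ do rewrite !mxE.
by rewrite !big_split /= -!mulr_sumr sX sY sZ; ring.
Qed.

Lemma mean_position_bounds (R : realType) (l m : nat) (a b : R) :
  0 <= a -> 0 <= b -> (l < m)%N ->
  0 <= (a * l%:R + b * l.+1%:R) / m%:R <= a + b.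
Proof.
move=> a0 b0 lm; have m0 : 0 < (m%:R : R) by rewrite ltr0n; lia.
rewrite divr_ge0 ?addr_ge0 ?mulr_ge0 //= ler_pdivrMr // mulrDl.
by apply: lerD; apply: ler_wpM2l => //; rewrite ler_nat // ltnW.
Qed.

Lemma position_on_path (R : realType) (m : nat) (S tau : R) :
  0 <= tau <= S -> exists2 l, (l < m.+1)%N & l%:R * S <= m.+1%:R * tau <= l.+1%:R * S.
Proof.
move=> /andP[t0 tS].
have : m.+1%:R * tau <= m.+1%:R * S by apply: ler_wpM2l.
set T := _ * tau; have T0 : 0 <= T by rewrite mulr_ge0.
(* The scaled position is generalized, so that the induction lengthens only the path. *)
move: T T0 => T T0; elim: m => [|m IH] le.
  by exists 0%N => //; rewrite mul0r T0.
have [le'|/ltW ge] := leP T (m.+1%:R * S).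
  by have [l lm lT] := IH le'; exists l => //; lia.
by exists m.+1; rewrite ?ge.
Qed.

(** By [sector_point_inj] the apex weights, leg masses and mean positions agree. If the leg mass is
    centred at an end of the leg, it all sits there, and that end belongs to a face read off from
    the image. Otherwise the two legs coincide and [consecutive_masses] applies. *)
Lemma pos_map_inj (R : realType) (n t : nat) (q : {set 'I_t} -> 'I_n)
    (s : {set 'I_t} -> 'I_t -> seq 'I_n) (x x' : 'rV[R]_n) :
  subdivision q s -> realization (facets q s) x -> realization (facets q s) x' ->
  pos_map q s x = pos_map q s x' -> x = x'.
Proof.
move=> sd /(realization_facetsP _ sd)[i [j [k [l [lam [a [b [ijk lm [l0 a0 b0] s1 ->]]]]]]]].
move=> /(realization_facetsP _ sd)[i' [j' [k' [l' [lam' [a' [b' [ijk' lm' [l0' a0' b0'] s1' ->]]]]]]]].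
rewrite !pos_map_facet_point //.
have tb := mean_position_bounds a0 b0 lm; have tb' := mean_position_bounds a0' b0' lm'.
move=> /(sector_point_inj ijk ijk' l0 tb s1 l0' tb' s1')[el et ei e2 e3].
have eS : a + b = a' + b' by lra.
rewrite /facet_point -!addrA; congr (_ + _).
  rewrite -el; have [/ei -> //|] := ltP 0 lam.
  move=> le; have -> : lam = 0 by lra.
  by rewrite !scale0r.
move: tb tb' et e2 e3.
set m := leg_len _ _ _; set m' := leg_len _ _ _.
set tau := _ / m%:R; set tau' := _ / m'%:R => /andP[t0 tS] /andP[t0' tS'] et e2 e3.
have m0 : (m%:R : R) != 0 by rewrite pnatr_eq0.
have m0' : (m'%:R : R) != 0 by rewrite pnatr_eq0.
have tauE : a * l%:R + b * l.+1%:R = tau * m%:R by rewrite /tau mulfVK.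
have tauE' : a' * l'%:R + b' * l'.+1%:R = tau' * m'%:R by rewrite /tau' mulfVK.
pose p A h w := unit_row R (leg q s A h w).
have [tz|tp] := eqVneq tau 0.
  rewrite -et tz mul0r in tauE tauE'.
  have -> : a *: p [set i; j] k l + b *: p [set i; j] k l.+1 =
      (a + b) *: p [set i; j] k 0 + 0 *: p [set i; j] k 1.
    apply: (consecutive_masses (p [set i; j] k)); rewrite ?lexx ?addr_ge0 ?addr0 //.
    by rewrite tauE !(mul0r, mulr0n, mulr0, addr0).
  have -> : a' *: p [set i'; j'] k' l' + b' *: p [set i'; j'] k' l'.+1 =
      (a' + b') *: p [set i'; j'] k' 0 + 0 *: p [set i'; j'] k' 1.
    apply: (consecutive_masses (p [set i'; j'] k')); rewrite ?lexx ?addr_ge0 ?addr0 //.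
    by rewrite tauE' !(mul0r, mulr0n, mulr0, addr0).
  rewrite !scale0r !addr0 -eS; have [lt|ge] := ltP tau (a + b).
    by rewrite /p /leg /= e2.
  have -> : a + b = 0 by lra.
  by rewrite !scale0r.
have tp' : 0 < tau by rewrite lt_neqAle eq_sym tp.
have [ts|ts] := eqVneq tau (a + b).
  rewrite -et ts in tauE tauE'.
  have -> : a *: p [set i; j] k l + b *: p [set i; j] k l.+1 =
      0 *: p [set i; j] k m.-1 + (a + b) *: p [set i; j] k m.-1.+1.
    apply: (consecutive_masses (p [set i; j] k)); rewrite ?lexx ?addr_ge0 ?add0r //.
    by rewrite mul0r add0r tauE.
  have -> : a' *: p [set i'; j'] k' l' + b' *: p [set i'; j'] k' l'.+1 =
      0 *: p [set i'; j'] k' m'.-1 + (a' + b') *: p [set i'; j'] k' m'.-1.+1.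
    apply: (consecutive_masses (p [set i'; j'] k')); rewrite ?lexx ?addr_ge0 ?add0r //.
    by rewrite mul0r add0r tauE' eS.
  by rewrite !scale0r !add0r -eS /p !leg_center e3.
have lt : tau < a + b by rewrite lt_neqAle ts.
(* Equal pairs and equal triples leave a single choice for the third vertex. *)
have eA := e2 lt; have := e3 tp'; rewrite -eA => /setP/(_ k).
have kij : k \notin [set i; j] by case/andP: ijk.
rewrite setU11 in_setU1 (negbTE kij) orbF => /esym/eqP ek.
have em : m = m' by rewrite /m /m' eA ek.
rewrite -ek; apply: (consecutive_masses (p [set i; j] k)) => //.
by rewrite tauE tauE' et em.
Qed.

Lemma sector_of_support (R : realType) (t : nat) (y : 'rV[R]_t) (e : {set 'I_t}) :
  #|e| = 3%N -> exists i j k,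
    [/\ sector i j k, e = k |: [set i; j], y ord0 j <= y ord0 i & y ord0 k <= y ord0 j].
Proof.
move=> e3; have /card_gt0P[a ae] : (0 < #|e|)%N by rewrite e3.
case: (Order.TotalTheory.arg_maxP (fun b => y ord0 b) ae) => i ie' maxi; have ie : i \in e by [].
have : #|e :\ i| == 2%N by move: e3; rewrite (cardsD1 i e) ie add1n => -[->].
case/cards2P => j0 [k0 [ne0 eq0]].
have [j [k [ne eq le]]] : exists j k, [/\ j != k, e :\ i = [set j; k] & y ord0 k <= y ord0 j].
  have [le|/ltW le] := leP (y ord0 k0) (y ord0 j0); first by exists j0, k0.
  by exists k0, j0; split=> //; rewrite 1?eq_sym // finset.setUC.
have je : j \in e :\ i by rewrite eq !inE eqxx.
have ke : k \in e :\ i by rewrite eq !inE eqxx orbT.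
move: je ke; rewrite !inE => /andP[ji je] /andP[ki ke].
exists i, j, k; split=> //; last exact: maxi.
- by rewrite /sector !inE negb_or eq_sym ji ki eq_sym ne.
- by rewrite -(finset.setD1K ie) eq (finset.setUA [set i]) finset.setUC.
Qed.

Lemma subdivision_homeomorphic (R : realType) (n t : nat) (q : {set 'I_t} -> 'I_n)
    (s : {set 'I_t} -> 'I_t -> seq 'I_n) :
  subdivision q s ->
  homeomorphic (@realization R n (facets q s)) (@realization R t (complete3 t)).
Proof.
move=> sd; apply: (compact_bijection_homeomorphic (f := pos_map q s)).
- exact: realization_compact.
- exact: continuous_pos_map.
- move=> x /(realization_facetsP _ sd)[i [j [k [l [lam [a [b [ijk lm [l0 a0 b0] s1 ->]]]]]]]].
  rewrite pos_map_facet_point //; have := mean_position_bounds a0 b0 lm.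
  set tau := _ / _; set S := a + b => /andP[t0 tS].
  split.
    move=> c; rewrite sector_pointE //.
    by case: ifP => _; [|case: ifP => _; [|case: ifP => _]]; lra.
  split; first by rewrite sum_sector_point.
  exists (k |: [set i; j]); first by rewrite inE; have [_ _ ->] := sector_cards ijk.
  move=> c; rewrite sector_pointE // !inE.
  by case: ifP => _; rewrite ?orbT //; case: ifP => _; rewrite ?orbT //;
    case: ifP => _; rewrite ?eqxx.
- by move=> x x'; apply: pos_map_inj.
- move=> y [y0 [y1 [e]]]; rewrite inE => /eqP e3 ye.
  have [i [j [k [ijk eE yij yjk]]]] := sector_of_support y e3.
  (* These solve the coordinate formula [sector_pointE] for [y]; the ordering of the coordinates
     makes [lam] and [S - tau] nonnegative. *)
  pose lam := y ord0 i - y ord0 j; pose S := 2 * y ord0 j + y ord0 k.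
  pose tau := 3 * y ord0 k.
  have yE : y = sector_point i j k lam S tau.
    apply/rowP => c; rewrite -[X in y X c]/ord0 -[X in _ = _ X c]/ord0 sector_pointE //.
    have [->|ci] := eqVneq c i; first by rewrite /lam /S /tau; lra.
    have [->|cj] := eqVneq c j; first by rewrite /lam /S /tau; lra.
    have [->|ck] := eqVneq c k; first by rewrite /tau; lra.
    apply/eqP; apply: contraT => /ye.
    by rewrite eE !inE (negbTE ci) (negbTE cj) (negbTE ck).
  have s1 : lam + S = 1 by rewrite -y1 [in RHS]yE sum_sector_point.
  have yj := y0 j; have yk := y0 k.
  have tS : 0 <= tau <= S by rewrite /tau /S; apply/andP; split; lra.
  have [l lm /andP[lS Sl]] := position_on_path (size (s [set i; j] k)) tS.
  pose m := leg_len s [set i; j] k.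
  (* The solution of [a + b = S] and [a * l + b * (l + 1) = m * tau], nonnegative by the choice of
     [l]. *)
  pose a := l.+1%:R * S - m%:R * tau; pose b := m%:R * tau - l%:R * S.
  have m0 : (m%:R : R) != 0 by rewrite pnatr_eq0.
  have abS : a + b = S by rewrite /a /b -natr1; ring.
  exists (facet_point q s i j k l lam a b).
    apply/(realization_facetsP _ sd); exists i, j, k, l, lam, a, b; split=> //.
      by split; rewrite ?subr_ge0.
    by rewrite abS.
  rewrite pos_map_facet_point // abS yE; congr (sector_point _ _ _ _ _ _).
  by rewrite -/m /a /b -natr1; field.
Qed.

(** Here [K_t^(3)] has no facets, so the empty subhypergraph has the same, empty, realization. *)
Lemma contains_hom_Kt_small (R : realType) (n t : nat) (E : {set {set 'I_n}}) :
  (t < 3)%N -> contains_hom_Kt R t E.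
Proof.
move=> t3; exists finset.set0; first exact: finset.sub0set.
have noA (x : 'rV[R]_n) : ~ realization finset.set0 x by move=> [_ [_ [e]]]; rewrite inE.
have noB (y : 'rV[R]_t) : ~ realization (complete3 t) y.
  move=> [_ [_ [e]]]; rewrite inE => /eqP e3 _.
  by have := max_card (mem e); rewrite e3 card_ord leqNgt t3.
apply: (compact_bijection_homeomorphic (f := fun=> 0)).
- exact: realization_compact.
- exact: cst_continuous.
- by move=> x /noA.
- by move=> x y /noA.
- by move=> y /noB.
Qed.

Lemma powR_8_3_cube (R : realType) (n : nat) :
  ((n%:R : R) `^ (8 / 3)) ^+ 3 = n%:R ^+ 8.
Proof.
rewrite -powR_mulrn ?powR_ge0 // -powRrM -powR_mulrn ?ler0n //.
by congr (_ `^ _); field.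
Qed.

Theorem theorem1p1 (R : realType) (t : nat) :
  exists C : R, forall (n : nat) (E : {set {set 'I_n}}),
    three_uniform E -> ~ contains_hom_Kt R t E ->
    (#|E|%:R : R) <= C * ((n%:R : R) `^ (8 / 3 : R)).
Proof.
have [t3|t3] := ltnP t 3.
  by exists 0 => n E _ []; apply: contains_hom_Kt_small.
have [C CP] := exists_facets_subset t3.
(* [C.+1] stands in for the cube root of [C], since [C <= C.+1 ^ 3]. *)
exists C.+1%:R => n E E3 noK; rewrite leNgt; apply/negP => Ebig; apply: noK.
have [|q [s [sd FE]]] := CP n E E3; last first.
  by exists (facets q s) => //; apply: subdivision_homeomorphic.
rewrite -(ltr_nat R) natrM !natrX.
have X0 : 0 <= C.+1%:R * (n%:R : R) `^ (8 / 3) by rewrite mulr_ge0 ?powR_ge0.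
have lt3 : (C.+1%:R * (n%:R : R) `^ (8 / 3)) ^+ 3 < #|E|%:R ^+ 3.
  by rewrite ltrXn2r // nnegrE.
apply: le_lt_trans lt3; rewrite exprMn powR_8_3_cube; apply: ler_wpM2r.
  by rewrite exprn_ge0.
by rewrite -natrX ler_nat; apply: (@leq_trans C.+1) => //; rewrite -[leqLHS]expn1 leq_pexp2l.
Qed.
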